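(* Let $\alpha\in(0,2)$, $a>0$, and let $\sigma:\mathbb{R}^2\times[0,\infty)\to\mathbb{R}$ be continuous and bounded, and suppose there is $\gamma\in(0,1]$ such that $|\sigma(x,t)-\sigma(x,s)|\le|t-s|^\gamma$ for all $t,s\ge0$, $x\in\mathbb{R}^2$. Let \[ U(x,t)=C_\alpha\sum_{k\ge1}\Gamma_k^{-1/\alpha}\varphi(\xi_k)^{-1/\alpha}G(x,\xi_k,t)g_k \] be the LePage-series realization of $\iint_{\mathbb{R}^2}G(x,y,t)M(dy)$. Then for any $T>0$ and $x\in\mathbb{R}^2$, the function $t\mapsto U(x,t)$ is almost surely Hölder continuous on $[0,T]$ with any exponent less than $\gamma\wedge\frac12$.
   Context: Define, for $x,y\in\mathbb{R}^2$, $t\ge0$, \[ G(x,y,t)=\frac{1}{2\pi a}\int_0^{t-\frac{|x-y|}{a}}\frac{\sigma(y,\tau)}{\sqrt{a^2(t-\tau)^2-|y-x|^2}}\,d\tau\;\mathbf{1}_{\{|x-y|<at\}}. \] LePage construction: $\varphi$ is a continuous, everywhere positive probability density on $\mathbb{R}^2$; $\{\Gamma_k\}$ are arrival times of a unit-intensity Poisson process, $\{\xi_k\}$ i.i.d. in $\mathbb{R}^2$ with density $\varphi$, $\{g_k\}$ i.i.d. centered Gaussian with $E|g_k|^\alpha=1$, the three families mutually independent; $C_\alpha=\big(\frac{\Gamma(2-\alpha)\cos(\pi\alpha/2)}{1-\alpha}\big)^{1/\alpha}$. The measure $M(A)=C_\alpha\sum_k\Gamma_k^{-1/\alpha}\varphi(\xi_k)^{-1/\alpha}\mathbf{1}_A(\xi_k)g_k$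 is an independently scattered symmetric $\alpha$-stable random measure on $\mathbb{R}^2$ with Lebesgue control measure; $U(x,t)$ is the candidate solution (Poisson's formula) of $\big(\frac{\partial^2}{\partial t^2}-a^2\Delta\big)U=\sigma\dot M$ with zero initial conditions. *)

(* Defs.v *)
From HB Require Import structures.
From mathcomp Require Import all_boot all_order all_algebra.
From mathcomp Require Import all_classical all_reals all_analysis.
From mathcomp Require Import exponential_distribution normal_distribution.
Set Implicit Arguments. Unset Strict Implicit. Unset Printing Implicit Defensive.
Import Order.TTheory GRing.Theory Num.Def Num.Theory.
Import numFieldNormedType.Exports.
Local Open Scope classical_set_scope.
Local Open Scope ring_scope.

Section defs.
Context {R : realType}.

Definition dist2 (x y : R * R) : R :=
  Num.sqrt ((x.1 - y.1) ^+ 2 + (x.2 - y.2) ^+ 2).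

Definition leb2 := ((@lebesgue_measure R) \x (@lebesgue_measure R))%E.

(* The kernel G(x,y,t) (Poisson's formula for the 2D wave equation). *)
Definition Gker (a : R) (sigma : R * R -> R -> R) (x y : R * R) (t : R) : R :=
  if dist2 x y < a * t then
    (2 * pi * a)^-1 *
    fine (\int[@lebesgue_measure R]_(tau in `[0, t - dist2 x y / a])
            (sigma y tau / Num.sqrt (a ^+ 2 * (t - tau) ^+ 2 - dist2 y x ^+ 2))%:E)
  else 0.

Definition GammaF (z : R) : R :=
  fine (\int[@lebesgue_measure R]_(u in `[0, +oo[) (u `^ (z - 1) * expR (- u))%:E).

(* C_alpha; at alpha = 1 the formula is read as its limit pi/2. *)
Definition Calpha (alpha : R) : R :=
  if alpha == 1 then pi / 2
  else (GammaF (2 - alpha) * cos (pi * alpha / 2) / (1 - alpha)) `^ alpha^-1.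

Definition preimg_sets d d' (Omega : measurableType d) (T : measurableType d')
  (X : Omega -> T) : set (set Omega) :=
  [set A | exists2 B, measurable B & A = X @^-1` B].

Definition mutually_independent d (Omega : measurableType d)
  (P : probability Omega R) (I : eqType) (F : I -> set (set Omega)) : Prop :=
  forall (J : seq I) (A : I -> set Omega), uniq J ->
    (forall i, i \in J -> F i (A i)) ->
    P (\bigcap_(i in [set j | j \in J]) A i) = (\prod_(i <- J) P (A i))%E.

Definition hoelder_on (T beta : R) (f : R -> R) : Prop :=
  exists C : R, forall s t, 0 <= s <= T -> 0 <= t <= T ->
    `|f t - f s| <= C * `|t - s| `^ beta.

(* The LePage setting: E_i i.i.d. Exp(1) (Gam k = E_0+...+E_k is the
   (k+1)-th arrival time of a unit-rate Poisson process), xi_k i.i.d. with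
   density phi, g_k i.i.d. centered Gaussian with E|g_k|^alpha = 1, the
   three families mutually independent. Index k : nat stands for k+1. *)
Definition lepage_setting d (Omega : measurableType d) (P : probability Omega R)
  (alpha : R) (phi : R * R -> R)
  (E : nat -> Omega -> R) (Gam : nat -> Omega -> R)
  (xi : nat -> Omega -> R * R) (g : nat -> Omega -> R) : Prop :=
  (forall k, measurable_fun setT (E k)) /\
      (forall k, measurable_fun setT (xi k)) /\
      (forall k, measurable_fun setT (g k)) /\
      (forall k A, measurable A -> P (E k @^-1` A) = exponential_prob 1 A) /\
      (forall k w, Gam k w = \sum_(i < k.+1) E i w) /\
      (forall k A, measurable A -> P (xi k @^-1` A) = (\int[leb2]_(y in A) (phi y)%:E)%E) /\
      (exists2 s : R, 0 < s & forall k A, measurable A ->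
          P (g k @^-1` A) = normal_prob 0 s A) /\
      (forall k, (\int[P]_w (`|g k w| `^ alpha)%:E)%E = 1%E) /\
      mutually_independent P
        (fun i : nat + (nat + nat) => match i with
          | inl k => preimg_sets (E k)
          | inr (inl k) => preimg_sets (xi k)
          | inr (inr k) => preimg_sets (g k) end).

Definition U_partial (alpha a : R) (sigma : R * R -> R -> R) (phi : R * R -> R)
  (Gam : nat -> R) (xi : nat -> R * R) (g : nat -> R)
  (x : R * R) (t : R) (N : nat) : R :=
  Calpha alpha * \sum_(k < N)
    (Gam k `^ (- alpha^-1) * phi (xi k) `^ (- alpha^-1) *
     Gker a sigma x (xi k) t * g k).

End defs.

(* Main.v *)
(** On [0, T] the kernel [Gker a sigma x y] vanishes unless r = |x - y| < a T.
    Its only singularity in time is an inverse square root at the light cone, so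
    its increments are bounded by C r^(-1/2) |t - s|^(1/2).
    Conditionally on the arrival times and the positions the series is
    Gaussian, with increments of variance at most |t - s| times
    V = C sum_k Gam_k^(-2/alpha) / r_k.  This is almost surely finite, even with
    extra weights k^(2 eps): Gam_k grows linearly, 2/alpha > 1, and 1/r is
    integrable in the plane.

    Instead of conditioning, one uses that exp (sum_k (b_k g_k - s^2 b_k^2 / 2))
    is a martingale when the b_k depend on the E's and xi's only.  Ville's
    inequality then bounds all partial sums of a given increment at once, with
    exponential tails, so that a union bound over dyadic increments and chaining
    give a Hoelder bound which is uniform in the number of terms.  Applied to the
    series weighted by k^eps, it yields convergence as well, by summation by
    parts against the weights k^(-eps). *)

Require Import Defs.
From HB Require Import structures.
From mathcomp Require Import all_boot all_order all_algebra.
From mathcomp Require Import all_classical all_reals all_analysis.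
From mathcomp Require Import measurable_realfun.
From mathcomp Require Import exponential_distribution normal_distribution.
From mathcomp Require Import zify ring lra.
Import Order.TTheory GRing.Theory Num.Def Num.Theory.
Import numFieldNormedType.Exports.
Local Open Scope classical_set_scope.
Local Open Scope ring_scope.

(** * Dyadic chaining *)

(** The obstacle is heavy tails: a nondegenerate alpha-stable variable has no moment of order alpha,
    so a moment criterion for continuity cannot be applied to U itself. The tails come from the
    arrival times, whence a random V and Gaussian bounds relative to it. Increments are divided by
    the square root of the time step, so that V serves all nodes at once. The parameter of the
    exponential is kept at 1: the resulting bound u + s^2 V / 2 is linear in the level u instead of
    optimal, but u = O(m) suffices at dyadic level m. It leaves m 2^(-m/2), which is O(2^(-beta m))
    exactly when beta < 1/2. All nodes are numbered by a single integer q and receive the budget 1 /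
    ((q + 1) (q + 2)), whose logarithm is linear in the level. Only countably many increments are
    involved, so one null set serves all t, all beta and all partial sums; between dyadic points the
    finite sums are controlled by their own continuity, with a constant that disappears in the
    limit. *)

Definition dyadic_floor {R : realType} (m : nat) (t : R) : R :=
  (Num.trunc (2 ^+ m * t))%:R / 2 ^+ m.

Section chaining.
Variable R : realType.
Implicit Types (f : R -> R) (K L theta t s : R).

Let p2 k : 0 < 2 ^+ k :> R. Proof. by rewrite exprn_gt0. Qed.

Let trunc2 m t : 0 <= t ->
  (Num.trunc (2 ^+ m * t))%:R <= 2 ^+ m * t < (Num.trunc (2 ^+ m * t)).+1%:R.
Proof. by move=> t0; apply: truncn_itv; rewrite mulr_ge0// ltW. Qed.

Lemma le_add_geometric (x y L q : R) : 0 <= q -> q < 1 ->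
  (forall j, x <= y + L * q ^+ j) -> x <= y.
Proof.
move=> q0 q1 h.
have := @cvg_geometric R L q; rewrite ger0_norm// => /(_ q1) g.
have g' : (fun j => y + geometric L q j) @ \oo --> y + 0.
  by apply: cvgD => //; exact: cvg_cst.
rewrite addr0 in g'.
apply: (ler_cvg_to (cvg_cst x) g').
by apply: nearW => j; exact: h.
Qed.

Lemma dyadic_floor_itv m t : 0 <= t ->
  dyadic_floor m t <= t < dyadic_floor m t + 2 ^- m.
Proof.
move=> t0; have /andP[h1 h2] := trunc2 m t t0; rewrite /dyadic_floor.
rewrite ler_pdivrMr// [t * _]mulrC h1/= -[X in _ + X]mul1r -mulrDl natr1.
by rewrite ltr_pdivlMr// mulrC.
Qed.

Lemma truncn_double m t : 0 <= t ->
  Num.trunc (2 ^+ m.+1 * t) = (Num.trunc (2 ^+ m * t)).*2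
  \/ Num.trunc (2 ^+ m.+1 * t) = (Num.trunc (2 ^+ m * t)).*2.+1.
Proof.
move=> t0; have /andP[h1 h2] := trunc2 m t t0.
set n := Num.trunc (2 ^+ m * t) in h1 h2 *.
have -> : 2 ^+ m.+1 * t = 2 * (2 ^+ m * t) by rewrite exprS mulrA.
have [lt|ge] := ltrP (2 * (2 ^+ m * t)) (n.*2.+1)%:R.
- left; apply: truncn_def; rewrite lt andbT -muln2 natrM.
  by rewrite mulrC ler_pM2l.
- right; apply: truncn_def; rewrite ge/=.
  have -> : n.*2.+2%:R = 2 * n.+1%:R :> R by rewrite -natrM mul2n.
  by rewrite ltr_pM2l.
Qed.

Definition dyadic_increments_le f K theta := forall m i, (i < 2 ^ m)%N ->
  `|f (i.+1%:R / 2 ^+ m) - f (i%:R / 2 ^+ m)| <= K * theta ^+ m.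

(** By [truncn_double] the two floors coincide or are neighbours on the finer grid, so that at most
    one increment of level m + 1 separates them. *)
Lemma dyadic_floor_step f K theta : 0 <= K -> 0 <= theta ->
  dyadic_increments_le f K theta -> forall m t, 0 <= t -> t <= 1 ->
  `|f (dyadic_floor m.+1 t) - f (dyadic_floor m t)| <= K * theta ^+ m.+1.
Proof.
move=> K0 th0 hf m t t0 t1.
rewrite /dyadic_floor; set n := Num.trunc (2 ^+ m * t).
have e : n%:R / 2 ^+ m = n.*2%:R / 2 ^+ m.+1 :> R.
  by rewrite -muln2 natrM exprS; field; rewrite gt_eqF.
have [->|eS] := truncn_double m t t0; rewrite -/n e.
  by rewrite subrr normr0 mulr_ge0// exprn_ge0.
rewrite eS; apply: hf.
rewrite -eS -(@ler_nat R) natrX.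
have /andP[h _] := trunc2 m.+1 t t0.
by apply: le_trans h _; rewrite ler_piMr// ltW.
Qed.

Lemma dyadic_floor_sum f K theta : 0 <= K -> 0 < theta -> theta < 1 ->
  dyadic_increments_le f K theta -> forall m j t, 0 <= t -> t <= 1 ->
  `|f (dyadic_floor (m + j) t) - f (dyadic_floor m t)|
    <= K * theta ^+ m / (1 - theta).
Proof.
move=> K0 th0 th1 hf m j t t0 t1.
have th1' : 0 < 1 - theta by rewrite subr_gt0.
(* The factor 1 - theta^j, that of a partial geometric sum, makes the induction on j close. *)
suff : `|f (dyadic_floor (m + j) t) - f (dyadic_floor m t)|
    <= K * theta ^+ m / (1 - theta) * (1 - theta ^+ j).
  move=> /le_trans; apply; rewrite ler_piMr//.
    by rewrite !mulr_ge0// ?invr_ge0 ?exprn_ge0 ?ltW.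
  by rewrite lerBlDr lerDl exprn_ge0// ltW.
elim: j => [|j IH]; first by rewrite addn0 subrr normr0 expr0 subrr mulr0.
have := dyadic_floor_step f K theta K0 (ltW th0) hf (m + j) t t0 t1.
rewrite addnS => h.
rewrite -[f (dyadic_floor (m + j).+1 t)](subrK (f (dyadic_floor (m + j) t))) -addrA.
apply: le_trans (ler_normD _ _) _; apply: le_trans (lerD h IH) _.
have -> : K * theta ^+ m / (1 - theta) * (1 - theta ^+ j.+1) =
  K * theta ^+ (m + j) + K * theta ^+ m / (1 - theta) * (1 - theta ^+ j).
  by rewrite exprD exprS; field; rewrite gt_eqF.
rewrite lerD2r ler_wpM2l// exprS ler_piMl ?exprn_ge0 ?ltW//.
Qed.

(** Stopping the chain at level m + j leaves an error of at most L 2^(-j/2). Letting j tend to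
    infinity removes L from the bound. *)
Lemma dyadic_floor_approx f K L theta : 0 <= K -> 0 < theta -> theta < 1 ->
  dyadic_increments_le f K theta ->
  (forall s t, 0 <= s <= 1 -> 0 <= t <= 1 ->
     `|f t - f s| <= L * Num.sqrt `|t - s|) ->
  forall m t, 0 <= t <= 1 ->
  `|f t - f (dyadic_floor m t)| <= K * theta ^+ m / (1 - theta).
Proof.
move=> K0 th0 th1 hf hL m t /andP[t0 t1].
have q1 : Num.sqrt (2^-1 : R) < 1 by rewrite -[ltRHS]sqrtr1 ltr_sqrt//; lra.
have L0 : 0 <= L.
  have := hL 0 1; rewrite subr0 !lexx ler01 => /(_ isT isT).
  by rewrite normr1 sqrtr1 mulr1; apply: le_trans.
apply: (@le_add_geometric _ _ L (Num.sqrt 2^-1)) => // j.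
have [h1 h2] := andP (dyadic_floor_itv (m + j) t t0).
have h0 : 0 <= dyadic_floor (m + j) t by rewrite divr_ge0// ltW.
have -> : f t - f (dyadic_floor m t) =
    (f (dyadic_floor (m + j) t) - f (dyadic_floor m t)) +
    (f t - f (dyadic_floor (m + j) t)) by ring.
apply: le_trans (ler_normD _ _) _; apply: lerD.
  exact: (dyadic_floor_sum f K theta K0 th0 th1 hf m j t t0 t1).
apply: le_trans (hL _ _ _ _) _; rewrite ?t0//.
  by rewrite h0 (le_trans h1).
rewrite ler_wpM2l//.
have -> : Num.sqrt (2^-1 : R) ^+ j = Num.sqrt (2^-1 ^+ j).
  by elim: j {h1 h2 h0} => [|j IH]; rewrite ?expr0 ?sqrtr1// !exprS sqrtrM ?invr_ge0// IH.
rewrite ler_wsqrtr// ger0_norm ?subr_ge0// exprVn.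
have : 2 ^- (m + j) <= 2 ^- j :> R by rewrite lef_pV2 ?posrE// ler_weXn2l ?ler1n// leq_addl.
by lra.
Qed.

Lemma powR_exprn (x b : R) m : 0 <= x -> (x `^ b) ^+ m = (x ^+ m) `^ b.
Proof.
move=> x0; rewrite -(powR_mulrn m x0) -(powR_mulrn m (powR_ge0 x b)).
by rewrite -powRrM -[RHS]powRrM mulrC.
Qed.

Lemma dyadic_scale (h : R) : 0 < h -> h <= 1 ->
  exists m, 2 ^- m.+1 < h <= 2 ^- m.
Proof.
move=> h0 h1.
have ex : exists n, (2 ^- n < h).
  have := @cvg_geometric R 1 2^-1; rewrite ger0_norm ?invr_ge0// => /(_ _) g.
  have {}g := g ltac:(by rewrite invf_lt1// ltr1n).
  have := cvgr_lt _ g _ h0.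
  by move=> [n _ /(_ n (leqnn n))]; rewrite /= mul1r exprVn => ?; exists n.
case: (ex_minnP ex) => -[|m] hm min; first by move: hm; rewrite expr0 invr1 ltNge h1.
by exists m; rewrite hm/= leNgt; apply/negP => /min; rewrite ltnn.
Qed.

(** At distance at most one mesh, the floors are equal or adjacent. *)
Lemma dyadic_floor_near f K theta : 0 <= K -> 0 <= theta ->
  dyadic_increments_le f K theta -> forall m s t, 0 <= s -> s <= t -> t <= 1 ->
  t - s <= 2 ^- m ->
  `|f (dyadic_floor m t) - f (dyadic_floor m s)| <= K * theta ^+ m.
Proof.
move=> K0 th0 hf m s t s0 st t1 hts; have t0 := le_trans s0 st.
have /andP[a1 a2] := trunc2 m t t0; have /andP[b1 b2] := trunc2 m s s0.
have le_st : 2 ^+ m * s <= 2 ^+ m * t by rewrite ler_pM2l.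
have : 2 ^+ m * t <= 2 ^+ m * s + 1.
  rewrite -lerBlDl -mulrBr mulrC -ler_pdivlMr//; by rewrite mul1r.
rewrite /dyadic_floor.
move: (Num.trunc (2 ^+ m * t)) (Num.trunc (2 ^+ m * s)) a1 a2 b1 b2.
move=> p q a1 a2 b1 b2 d.
have pq : (q <= p)%N by rewrite -ltnS -(@ltr_nat R); lra.
have qp : (p <= q.+1)%N.
  by rewrite -ltnS -(@ltr_nat R); move: b2; rewrite -[q.+2%:R]natr1; lra.
have [pq'|pq'] : p = q \/ p = q.+1.
  by case: (leqP p q) => h; [left|right]; apply/eqP; rewrite eqn_leq ?pq ?qp h.
- by rewrite pq' subrr normr0 mulr_ge0// exprn_ge0.
- rewrite pq'; apply: hf; rewrite -(@ler_nat R) natrX -pq'.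
  by apply: le_trans a1 _; rewrite ler_piMr// ltW.
Qed.

Lemma dyadic_chaining_unit (beta : R) : 0 < beta ->
  exists2 C, 0 <= C & forall f K L, 0 <= K ->
  (forall s t, 0 <= s <= 1 -> 0 <= t <= 1 ->
     `|f t - f s| <= L * Num.sqrt `|t - s|) ->
  dyadic_increments_le f K (2^-1 `^ beta) ->
  forall s t, 0 <= s <= 1 -> 0 <= t <= 1 ->
    `|f t - f s| <= C * K * `|t - s| `^ beta.
Proof.
move=> b0; set th := (2^-1 : R) `^ beta.
have th0 : 0 < th by rewrite powR_gt0.
have th1 : th < 1.
  by rewrite -[ltRHS](@powRr0 _ 2^-1) /th /powR gt_eqF// ltr_expR ltr_nM2r ?ln_lt0//; lra.
have th1' : 0 < 1 - th by rewrite subr_gt0.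
(* Two approximation errors and one increment between floors give the sum. The factor [2 ^ beta]
   arises because the chosen level satisfies 2^(-m) < 2 |t - s|, while th^m = (2^(-m))^beta. *)
pose C := (2 / (1 - th) + 1) * 2 `^ beta.
have C1 : 0 < 2 / (1 - th) + 1 by rewrite addr_gt0// divr_gt0.
exists C; first by rewrite mulr_ge0 ?powR_ge0// ltW.
move=> f K L K0 hL hf.
have main s t : 0 <= s -> s < t -> t <= 1 ->
    `|f t - f s| <= C * K * `|t - s| `^ beta.
  move=> s0 st t1; have t0 := le_trans s0 (ltW st).
  have s1 : s <= 1 by rewrite (le_trans (ltW st)).
  have [m /andP[m1 m2]] := dyadic_scale (t - s) ltac:(lra) ltac:(lra).
  have -> : f t - f s = (f t - f (dyadic_floor m t))
     + (f (dyadic_floor m t) - f (dyadic_floor m s))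
     - (f s - f (dyadic_floor m s)) by ring.
  apply: le_trans (ler_normB _ _) _.
  have h1 := dyadic_floor_near f K th K0 (ltW th0) hf m s t s0 (ltW st) t1 m2.
  have ap := dyadic_floor_approx f K L th K0 th0 th1 hf hL m.
  have h2 := ap t ltac:(by rewrite t0 t1).
  have h3 := ap s ltac:(by rewrite s0 s1).
  have h4 := ler_normD (f t - f (dyadic_floor m t)) (f (dyadic_floor m t) - f (dyadic_floor m s)).
  apply: (@le_trans _ _ ((2 / (1 - th) + 1) * (K * th ^+ m))); first by lra.
  rewrite /C -!mulrA ler_pM2l// [leRHS]mulrCA ler_wpM2l//.
  rewrite -powRM//.
  have -> : th ^+ m = (2^-1 ^+ m) `^ beta.
    exact: powR_exprn.
  apply: ge0_ler_powR; rewrite ?nnegrE ?mulr_ge0 ?normr_ge0 ?exprn_ge0 ?ltW//.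
  rewrite ger0_norm ?subr_ge0 ?(ltW st)//.
  by move: m1; rewrite exprVn exprS invfM; lra.
move=> s t /andP[s0 s1] /andP[t0 t1].
have [st|ts|->] := ltgtP s t.
- exact: main.
- by rewrite distrC [`|t - s|]distrC; exact: main.
- by rewrite !subrr normr0 mulr_ge0// ?powR_ge0// mulr_ge0// mulr_ge0 ?powR_ge0 ?ltW.
Qed.

(* [L] only provides continuity: [C] does not depend on it. *)
Lemma dyadic_chaining (T beta : R) : 0 < T -> 0 < beta ->
  exists2 C, 0 <= C & forall f K L, 0 <= K ->
  (forall s t, 0 <= s <= T -> 0 <= t <= T ->
     `|f t - f s| <= L * Num.sqrt `|t - s|) ->
  dyadic_increments_le (fun u => f (T * u)) K (2^-1 `^ beta) ->
  forall s t, 0 <= s <= T -> 0 <= t <= T ->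
    `|f t - f s| <= C * K * `|t - s| `^ beta.
Proof.
move=> T0 b0; have [C C0 hC] := dyadic_chaining_unit beta b0.
exists (C / T `^ beta); first by rewrite divr_ge0 ?powR_ge0.
move=> f K L K0 hL hf s t /andP[s0 sT] /andP[t0 tT].
have TT u : 0 <= u <= 1 -> 0 <= T * u <= T.
  move=> /andP[u0 u1]; apply/andP; split; first by rewrite mulr_ge0// ltW.
  by rewrite -[leRHS]mulr1 ler_pM2l.
have unit u : 0 <= u -> u <= T -> 0 <= u / T <= 1.
  by move=> u0 uT; rewrite ler_pdivrMr// mul1r uT divr_ge0// ltW.
have := hC _ K (L * Num.sqrt T) K0 _ hf (s / T) (t / T) _ _.
rewrite ![T * (_ / T)]mulrCA divff ?gt_eqF// !mulr1 => h.
have {h} := h _ (unit s s0 sT) (unit t t0 tT).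
have T0' := ltW T0; have Ti : 0 <= T^-1 by rewrite invr_ge0.
rewrite -mulrBl normrM (ger0_norm Ti) powRM// => h.
have -> : C / T `^ beta * K * `|t - s| `^ beta = C * K * (`|t - s| `^ beta * T^-1 `^ beta).
  rewrite -(powR_inv1 (powR_ge0 T beta)) -(powR_inv1 T0').
  by rewrite -[T `^ beta `^ _]powRrM -[T `^ _ `^ beta]powRrM [beta * -1]mulrC; ring.
apply: h => u v hu hv.
apply: le_trans (hL _ _ (TT _ hu) (TT _ hv)) _.
by rewrite -mulrBr normrM (ger0_norm T0') -mulrA sqrtrM.
Qed.

End chaining.

(** * Series *)

Section summation_by_parts.
Variable R : realType.
Variables (v Y : nat -> R) (C : R).
Hypotheses (v_ge0 : forall k, 0 <= v k) (v_dec : forall k, v k.+1 <= v k).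
Hypotheses (Y0 : Y 0%N = 0) (YC : forall n, `|Y n| <= C).

Lemma sum_by_parts n : \sum_(k < n) v k * (Y k.+1 - Y k) =
  v n * Y n + \sum_(k < n) (v k - v k.+1) * Y k.+1.
Proof.
elim: n => [|n IH]; first by rewrite !big_ord0 Y0 mulr0 addr0.
by rewrite !big_ord_recr/= IH; ring.
Qed.

Let C0 : 0 <= C. Proof. exact: le_trans (normr_ge0 _) (YC 0%N). Qed.

Let term_le k : `|(v k - v k.+1) * Y k.+1| <= C * (v k - v k.+1).
Proof.
have h : 0 <= v k - v k.+1 by rewrite subr_ge0.
by rewrite normrM (ger0_norm h) mulrC ler_wpM2r.
Qed.

Let sum_term_le n : \sum_(k < n) `|(v k - v k.+1) * Y k.+1| <= C * (v 0%N - v n).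
Proof.
apply: (@le_trans _ _ (\sum_(k < n) C * (v k - v k.+1))); first exact: ler_sum.
rewrite -mulr_sumr; suff -> : \sum_(k < n) (v k - v k.+1) = v 0%N - v n by [].
elim: n => [|n IH]; first by rewrite big_ord0 subrr.
by rewrite big_ord_recr/= IH; ring.
Qed.

(** The variation of the decreasing v telescopes to v 0 - v n, and the boundary term contributes the
    missing v n. *)
Lemma sum_by_parts_le n : `|\sum_(k < n) v k * (Y k.+1 - Y k)| <= C * v 0%N.
Proof.
rewrite sum_by_parts; apply: le_trans (ler_normD _ _) _.
apply: (@le_trans _ _ (C * v n + C * (v 0%N - v n))); last by rewrite -mulrDr addrC subrK.
apply: lerD; first by rewrite normrM (ger0_norm (v_ge0 n)) mulrC ler_wpM2r.
by apply: le_trans (ler_norm_sum _ _ _) _.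
Qed.

(** Dirichlet's test: the boundary term vanishes in the limit and the remaining series converges
    absolutely. *)
Lemma sum_by_parts_cvg : v @ \oo --> 0 ->
  cvgn (fun n => \sum_(k < n) v k * (Y k.+1 - Y k)).
Proof.
move=> v0; under eq_fun do rewrite sum_by_parts.
apply: is_cvgD.
  apply/cvg_ex; exists 0; apply/cvgr0Pnorm_le => e e0.
  have e1 : 0 < e / (C + 1) by rewrite divr_gt0// ltr_wpDl.
  have /cvgr0Pnorm_le /(_ _ e1) := v0; apply: filterS => n hn.
  rewrite normrM; apply: (@le_trans _ _ (e / (C + 1) * (C + 1))).
    by apply: ler_pM => //; apply: le_trans (YC n) _; rewrite lerDl ler01.
  by rewrite divfK// gt_eqF// ltr_wpDl.
have : cvgn [normed series (fun k => (v k - v k.+1) * Y k.+1)].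
  apply: nondecreasing_is_cvgn.
    by apply: nondecreasing_series => k _ _; exact: normr_ge0.
  exists (C * v 0%N) => _ [n _ <-].
  rewrite /normed_series_of/= /series/= big_mkord.
  by apply: le_trans (sum_term_le n) _; rewrite ler_wpM2l// gerBl.
by move=> /normed_cvg; rewrite seriesEord.
Qed.

End summation_by_parts.

Section geometric_growth.
Variable R : realType.

Lemma natr_expr_le (r : R) m : 0 < r -> r < 1 -> m%:R * r ^+ m <= r / (1 - r).
Proof.
move=> r0 r1; have r1' : 0 < 1 - r by rewrite subr_gt0.
elim: m => [|m IH]; first by rewrite mul0r divr_ge0 ?ltW.
have h : r ^+ m <= 1 by rewrite exprn_ile1 ?ltW.
rewrite exprS -natr1 mulrCA mulrDl mul1r.
apply: (@le_trans _ _ (r * (r / (1 - r) + 1))).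
  by rewrite ler_pM2l// lerD.
by rewrite le_eqVlt; apply/orP; left; apply/eqP; field; rewrite gt_eqF.
Qed.

(** The linear factor, the cost of the union bound at level m, is absorbed by passing from the ratio
    q = 2^(-1/2) to theta = 2^(-beta). The constant is [natr_expr_le] at r = q / theta. *)
Lemma affine_expr_le (q theta a b : R) m : 0 < q -> q < theta -> 0 <= a -> 0 <= b ->
  (a * m%:R + b) * q ^+ m <= (a * (q / (theta - q)) + b) * theta ^+ m.
Proof.
move=> q0 qt a0 b0; have t0 := lt_trans q0 qt.
pose r := q / theta.
have r0 : 0 < r by rewrite divr_gt0.
have r1 : r < 1 by rewrite ltr_pdivrMr// mul1r.
have -> : q ^+ m = r ^+ m * theta ^+ m by rewrite -exprMn divfK// gt_eqF.
rewrite mulrA ler_wpM2r ?(exprn_ge0 _ (ltW t0))//.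
have -> : q / (theta - q) = r / (1 - r).
  by rewrite /r; field; rewrite !gt_eqF// subr_gt0.
have := natr_expr_le r m r0 r1 => h.
have h1 : r ^+ m <= 1 by rewrite exprn_ile1 ?ltW.
rewrite mulrDl; apply: lerD; last by rewrite ler_piMr.
by rewrite -mulrA ler_wpM2l.
Qed.

End geometric_growth.

Set Implicit Arguments.
Unset Strict Implicit.

(** * Independence *)

Section independence.
Context d (Omega : measurableType d) (R : realType) (P : probability Omega R).
Variables (I : eqType) (F : I -> set (set Omega)).
Hypothesis F_setI : forall i, setI_closed (F i).
Hypothesis F_setT : forall i, F i setT.
Hypothesis F_measurable : forall i A, F i A -> measurable A.
Hypothesis F_indep : mutually_independent P F.

(** A pi-system that generates the joint sigma-algebra of the families in H and on which mutual
    independence can be read off directly. *)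
Definition cylinders (H : pred I) : set (set Omega) :=
  [set D | exists J A, [/\ uniq J, all H J, (forall i, i \in J -> F i (A i)) &
    D = \bigcap_(i in [set j | j \in J]) A i]].

Lemma cylinders_sub (H : pred I) i A : H i -> F i A -> cylinders H A.
Proof.
move=> Hi FA; exists [:: i], (fun=> A); split => //=; first by rewrite Hi.
  by move=> j; rewrite inE => /eqP->.
rewrite eqEsubset; split=> [w Aw j //|w]; apply => /=; exact: mem_head.
Qed.

Lemma cylinders_setT (H : pred I) : cylinders H setT.
Proof.
exists [::], (fun=> setT); split => //.
by rewrite eqEsubset; split.
Qed.

Lemma cylinders_setI (H : pred I) : setI_closed (cylinders H).
Proof.
move=> _ _ [J [A [uJ HJ FJ ->]]] [K [B [uK HK FK ->]]].
pose C i := (if i \in J then A i else setT) `&` (if i \in K then B i else setT).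
exists (undup (J ++ K)), C; split.
- exact: undup_uniq.
- apply/allP => i; rewrite mem_undup mem_cat => /orP[/(allP HJ)|/(allP HK)] //.
- move=> i _; apply: F_setI.
    by case: ifPn => [/FJ|_].
  by case: ifPn => [/FK|_].
- rewrite eqEsubset; split.
    move=> w [wJ wK] i /= _; split; case: ifPn => // iJ; [exact: wJ|exact: wK].
  move=> w wC; split=> i /= iJ; have := wC i; rewrite /= mem_undup mem_cat iJ ?orbT => /(_ isT) [];
    by rewrite iJ.
Qed.

Lemma cylinders_measurable (H : pred I) : cylinders H `<=` measurable.
Proof.
move=> _ [J [A [_ _ FJ ->]]]; apply: fin_bigcap_measurable => //= i iJ.
exact: F_measurable (FJ i iJ).
Qed.

Lemma cylinders_indep (H : pred I) j D B : ~~ H j -> cylinders H D -> F j B ->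
  P (D `&` B) = (P D * P B)%E.
Proof.
move=> Hj [J [A [uJ HJ FJ ->]]] FB.
have jJ : j \notin J by apply: contra Hj => /(allP HJ).
pose A' i := if i == j then B else A i.
have A'E i : i \in J -> A' i = A i.
  by move=> iJ; rewrite /A'; case: eqP => // ij; move: jJ; rewrite -ij iJ.
have e : \bigcap_(i in [set j | j \in J]) A i `&` B =
    \bigcap_(i in [set k | k \in j :: J]) A' i.
  rewrite eqEsubset; split=> [w [wA wB] i /=|w wA].
    rewrite inE => /orP[/eqP->|iJ]; first by rewrite /A' eqxx.
    by rewrite A'E//; exact: wA.
  split=> [i /= iJ|]; first by rewrite -A'E//; apply: wA; rewrite /= inE iJ orbT.
  by have := wA j; rewrite /A' eqxx; apply; rewrite /= mem_head.
rewrite e F_indep/= ?jJ//; last first.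
  by move=> i; rewrite inE => /orP[/eqP->|iJ]; [rewrite /A' eqxx|rewrite A'E//; exact: FJ].
rewrite big_cons F_indep// muleC; congr (_ * _)%E; last by rewrite /A' eqxx.
by apply: eq_big_seq => i iJ; rewrite A'E.
Qed.

(** As functions of D both sides are finite measures, [P] restricted to B and [P] scaled by P B.
    They agree on a pi-system, hence on what it generates. *)
Lemma sigma_cylinders_indep (H : pred I) j D B : ~~ H j ->
  <<s cylinders H >> D -> F j B -> P (D `&` B) = (P D * P B)%E.
Proof.
move=> Hj sD FB.
have mB : measurable B := F_measurable FB.
have PB0 : 0 <= fine (P B) by rewrite fine_ge0.
pose r : {nonneg R} := NngNum PB0.
have rE : r%:num%:E = P B by rewrite /= fineK// fin_num_measure.
have -> : (P D * P B)%E = mscale r P D by rewrite /mscale rE muleC.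
have -> : P (D `&` B) = mrestr P mB D by [].
apply: (@g_sigma_algebra_measure_unique _ _ _ (cylinders H)
  (@cylinders_measurable H) (fun=> setT) (fun=> cylinders_setT H) _
  (mrestr P mB) (mscale r P) (@cylinders_setI H) _ _ D sD).
- by rewrite bigcup_const//; exists 0%N.
- move=> A cA; rewrite [RHS](_ : _ = (P A * P B)%E); last first.
    by rewrite muleC -rE.
  exact: (@cylinders_indep H j _ _ Hj).
- move=> _; change (P (setT `&` B) < +oo)%E; by rewrite setTI (le_lt_trans (probability_le1 _ _))// ltry.
Qed.

(* Measurability for the sigma-algebra generated by the [F i] with [H i]:
   [Omega] is retyped as the corresponding measurable space. *)
Definition measurable_wrt (H : pred I) d' (T : measurableType d') (V : Omega -> T) :=
  measurable_fun setT (V : g_sigma_algebraType (cylinders H) -> T).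

Lemma measurable_wrt_measurable (H : pred I) d' (T : measurableType d')
  (V : Omega -> T) : measurable_wrt H V -> measurable_fun setT V.
Proof.
move=> mV _ B mB; have := mV measurableT B mB; rewrite !setTI.
exact: (smallest_sub (@sigma_algebra_measurable _ Omega) (@cylinders_measurable H)).
Qed.

Lemma measurable_wrt_gen (H : pred I) i d' (T : measurableType d') (X : Omega -> T) :
  H i -> (forall B, measurable B -> F i (X @^-1` B)) -> measurable_wrt H X.
Proof.
move=> Hi FX _ B mB; rewrite setTI.
by apply: sub_sigma_algebra; exact: cylinders_sub Hi (FX B mB).
Qed.

Lemma measurable_wrt_sub (H H' : pred I) d' (T : measurableType d') (X : Omega -> T) :
  {subset H <= H'} -> measurable_wrt H X -> measurable_wrt H' X.
Proof.
move=> HH' mX _ B mB; have := mX measurableT B mB.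
suff : <<s cylinders H >> `<=` <<s cylinders H' >> by apply.
apply: sub_sigma_algebra2 => D [J [A [uJ HJ FJ ->]]].
by exists J, A; split => //; apply: sub_all HJ => k; exact: HH'.
Qed.

(** The substitute for conditioning on V: agreement on rectangles identifies the joint law of V and
    X with the product of their laws, and Tonelli's theorem integrates X first. *)
Lemma indep_integral (H : pred I) j d1 (T1 : measurableType d1)
    d2 (T2 : measurableType d2) (V : Omega -> T1) (X : Omega -> T2)
    (f : T1 * T2 -> \bar R) :
  ~~ H j -> measurable_wrt H V -> (forall B, measurable B -> F j (X @^-1` B)) ->
  measurable_fun setT f -> (forall z, (0 <= f z)%E) ->
  (\int[P]_w f (V w, X w) = \int[P]_w \int[P]_w' f (V w, X w'))%E.
Proof.
move=> Hj mV FX mf f0.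
have mV' := measurable_wrt_measurable mV.
have mX : measurable_fun setT X.
  by move=> _ B mB; rewrite setTI; exact: F_measurable (FX B mB).
have mVX : measurable_fun setT (fun w => (V w, X w)) by exact/measurable_fun_pair.
pose V' : {mfun Omega >-> T1} := HB.pack V (isMeasurableFun.Build _ _ _ _ _ mV').
pose X' : {mfun Omega >-> T2} := HB.pack X (isMeasurableFun.Build _ _ _ _ _ mX).
pose W' : {mfun Omega >-> (T1 * T2)%type} :=
  HB.pack (fun w => (V w, X w)) (isMeasurableFun.Build _ _ _ _ _ mVX).
rewrite -[LHS](@ge0_integral_distribution _ _ _ _ _ P W' f mf f0).
have e A : measurable A -> (distribution P V' \x distribution P X')%E A = distribution P W' A.
  apply: product_measure_unique => B C mB mC.
  rewrite /distribution /pushforward /= -(@sigma_cylinders_indep H j)//.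
  - by have := mV measurableT B mB; rewrite setTI.
  - exact: FX.
transitivity (\int[(distribution P V' \x distribution P X')%E]_z f z)%E.
  by apply: eq_measure_integral => A mA _; exact/esym/e.
rewrite fubini_tonelli1//=.
rewrite (@ge0_integral_distribution _ _ _ _ _ P V').
- apply: eq_integral => w _ /=; rewrite /fubini_F.
  rewrite (@ge0_integral_distribution _ _ _ _ _ P X')//.
  by apply: measurableT_comp => //; exact: measurable_pair1.
- exact: measurable_fun_fubini_tonelli_F.
- by move=> y; apply: integral_ge0.
Qed.

End independence.

(** * The exponential supermartingale *)

Section exponential_supermartingale.
Context d (Omega : measurableType d) (R : realType) (P : probability Omega R).
Variables (I : eqType) (F : I -> set (set Omega)).
Hypothesis F_setI : forall i, setI_closed (F i).
Hypothesis F_setT : forall i, F i setT.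
Hypothesis F_measurable : forall i A, F i A -> measurable A.
Hypothesis F_indep : mutually_independent P F.
Variables (H0 : pred I) (j : nat -> I) (g : nat -> Omega -> R) (s : R).
Hypothesis j_inj : injective j.
Hypothesis H0j : forall k, ~~ H0 (j k).
Hypothesis g_F : forall k B, measurable B -> F (j k) (g k @^-1` B).
Hypothesis g_mgf : forall k (x : R),
  (\int[P]_w (expR (x * g k w - s ^+ 2 / 2 * x ^+ 2))%:E = 1)%E.

(** The filtration: the families of [H0] are known from the start, and g_0, ..., g_(n-1) have been
    revealed by time n. *)
Definition past (n : nat) : pred I :=
  fun i => H0 i || (i \in [seq j k | k <- iota 0 n]).

Let past_notin n : ~~ past n (j n).
Proof.
rewrite /past negb_or H0j/=; apply/negP => /mapP[k].
by rewrite mem_iota => /andP[_ kn] /j_inj nk; move: kn; rewrite -nk ltnn.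
Qed.

Let past_sub n : {subset past n <= past n.+1}.
Proof.
move=> i /orP[h|/mapP[k]]; first by apply/orP; left.
rewrite mem_iota add0n => /andP[_ kn] ->; apply/orP; right.
by apply/mapP; exists k => //; rewrite mem_iota/= add0n ltnW.
Qed.

Let H0_past n : {subset H0 <= past n}.
Proof. by move=> i h; apply/orP; left. Qed.

Let past_last n : past n.+1 (j n).
Proof. by apply/orP; right; apply/mapP; exists n => //; rewrite mem_iota/= add0n. Qed.

Local Notation measurable_on H := (measurable_wrt F H).

Section stopped.
Variables (b : nat -> Omega -> R).
Hypothesis b_meas : forall k, measurable_on H0 (b k).

(* The sum is frozen once it has reached [u]: its exponential keeps mean 1, so
   that Markov's inequality for the n-th term controls the maximum up to n. *)
Fixpoint stopped_sum (u : R) (n : nat) (w : Omega) : R :=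
  if n is n'.+1 then
    let x := stopped_sum u n' w in
    if x < u then x + (b n' w * g n' w - s ^+ 2 / 2 * b n' w ^+ 2) else x
  else 0.

Let stopped_sum_measurable u n : measurable_on (past n) (stopped_sum u n).
Proof.
elim: n => [|n IH]; first exact: measurable_cst.
have mW : measurable_on (past n.+1) (stopped_sum u n).
  exact: measurable_wrt_sub IH.
have mb : measurable_on (past n.+1) (b n).
  by apply: measurable_wrt_sub (b_meas n).
have mg : measurable_on (past n.+1) (g n).
  exact: measurable_wrt_gen (past_last n) (g_F n).
apply: measurable_fun_ifT => //=; first exact: measurable_fun_ltr.
apply: measurable_funD => //; apply: measurable_funB.
  exact: measurable_funM.
by apply: measurable_funM => //; exact: measurable_funX.
Qed.

Let stopped_sum_mfun u n : measurable_fun setT (stopped_sum u n).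
Proof. exact: (measurable_wrt_measurable F_measurable (@stopped_sum_measurable u n)). Qed.

Lemma measurable_stopped_sum_ge u n : measurable [set w | u <= stopped_sum u n w].
Proof.
have -> : [set w | u <= stopped_sum u n w] = setT `&` stopped_sum u n @^-1` `[u, +oo[.
  by apply/seteqP; split => w /=; rewrite in_itv/= andbT => // -[].
exact: stopped_sum_mfun.
Qed.

(** Whether the sum is frozen and the value of b_n are both known to [past n], and g_n is
    independent of it. So the new factor is either 1 or, integrated over g_n alone, has mean 1 by
    [g_mgf]. *)
Lemma integral_stopped_sum u n :
  (\int[P]_w (expR (stopped_sum u n w))%:E = 1)%E.
Proof.
elim: n => [|n IH].
  under eq_integral do rewrite /= expR0.
  by rewrite integral_cst//= mul1e probability_setT.
pose f (z : (R * R) * R) : \bar R :=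
  (expR (if z.1.1 < u then
     z.1.1 + (z.1.2 * z.2 - s ^+ 2 / 2 * z.1.2 ^+ 2) else z.1.1))%:E.
have mf : measurable_fun setT f.
  have m11 : measurable_fun setT (fun z : (R * R) * R => z.1.1).
    by apply: measurableT_comp.
  have m12 : measurable_fun setT (fun z : (R * R) * R => z.1.2).
    by apply: measurableT_comp.
  apply/measurable_EFinP; apply: measurableT_comp => //.
  apply: measurable_fun_ifT => //; first exact: measurable_fun_ltr.
  apply: measurable_funD => //; apply: measurable_funB.
    exact: measurable_funM.
  by apply: measurable_funM => //; exact: measurable_funX.
pose V w := (stopped_sum u n w, b n w).
have mV : measurable_on (past n) V.
  apply/measurable_fun_pair; first exact: stopped_sum_measurable.
  by apply: measurable_wrt_sub (b_meas n).
transitivity (\int[P]_w f (V w, g n w))%E; first by [].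
rewrite (indep_integral F_setI F_setT F_measurable F_indep (past_notin n) mV (g_F n))//; last first.
  by move=> z; rewrite lee_fin expR_ge0.
rewrite -IH; apply: eq_integral => w _.
rewrite /f /=; case: (boolP (stopped_sum u n w < u)) => _; last first.
  by rewrite integral_cst//= probability_setT mule1.
under eq_integral do rewrite expRD EFinM.
rewrite ge0_integralZl//.
- by rewrite g_mgf mule1.
- apply/measurable_EFinP; apply: measurableT_comp => //; apply: measurable_funB => //.
  apply: measurable_funM => //.
  by move=> _ B mB; rewrite setTI; exact: (F_measurable (g_F n mB)).
Qed.

Lemma stopped_sum_tail u n :
  (P [set w | (u <= stopped_sum u n w)%R] <= (expR (- u))%:E)%E.
Proof.
have mA := measurable_stopped_sum_ge u n.
have mexp : measurable_fun setT (fun w => (expR (stopped_sum u n w))%:E).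
  apply/measurable_EFinP; exact: measurableT_comp.
suff : ((expR u)%:E * P [set w | (u <= stopped_sum u n w)%R] <= 1)%E.
  by rewrite -lee_pdivlMl ?expR_gt0// -expRN mule1.
have -> : P [set w | (u <= stopped_sum u n w)%R] =
    (\int[P]_w (\1_[set w | (u <= stopped_sum u n w)%R] w)%:E)%E.
  by rewrite integral_indic// setIT.
rewrite -(integral_stopped_sum u n) -ge0_integralZl//; last first.
  exact/measurable_EFinP/measurable_indic.
apply: ge0_le_integral => //.
- by apply: measurable_funeM; exact/measurable_EFinP/measurable_indic.
move=> w _; rewrite lee_fin indicE; case: (boolP (w \in _)) => [|_].
  by rewrite inE/= mulr1 ler_expR.
by rewrite mulr0 expR_ge0.
Qed.

Let raw_sum n w := \sum_(k < n) (b k w * g k w - s ^+ 2 / 2 * b k w ^+ 2).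

Lemma stopped_sum_raw u n w : stopped_sum u n w < u ->
  stopped_sum u n w = raw_sum n w.
Proof.
elim: n => [|n IH]; first by rewrite /raw_sum big_ord0.
rewrite /raw_sum big_ord_recr/=; case: ifPn => [lt _|/negP].
  by rewrite IH.
by [].
Qed.

(** A sum frozen at or above u stays there, so the events increase with n and the bound, uniform in
    n, passes to their union. Outside the union no freezing ever occurs, and the stopped sum is the
    true one. *)
Lemma ville u : exists2 A, measurable A & (P A <= (expR (- u))%:E)%E /\
  forall w, ~ A w -> forall n, \sum_(k < n) b k w * g k w
     <= u + s ^+ 2 / 2 * \sum_(k < n) b k w ^+ 2.
Proof.
pose A n := [set w | u <= stopped_sum u n w].
have mA n : measurable (A n) by exact: measurable_stopped_sum_ge.
have mUA : measurable (\bigcup_n A n) by exact: bigcupT_measurable.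
have ndA : nondecreasing_seq A.
  apply/nondecreasing_seqP => n; apply/subsetPset => w; rewrite /A/=.
  by rewrite leNgt => /negbTE nlt; rewrite nlt leNgt nlt.
exists (\bigcup_n A n) => //; split.
  have h := nondecreasing_cvg_mu (mu := P) mA mUA ndA.
  rewrite -(cvg_lim _ h)//; apply: lime_le; first by apply/cvg_ex; eexists; exact: h.
  by apply: nearW => n; exact: stopped_sum_tail.
move=> w nAw n; have lt : stopped_sum u n w < u.
  by rewrite ltNge; apply/negP => h; apply: nAw; exists n.
have := stopped_sum_raw lt => e; move: lt; rewrite e /raw_sum.
by rewrite sumrB -mulr_sumr ltrBlDr => /ltW.
Qed.

End stopped.

Lemma ville_abs (b : nat -> Omega -> R) u :
  (forall k, measurable_on H0 (b k)) ->
  exists2 A, measurable A & (P A <= (2 * expR (- u))%:E)%E /\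
  forall w, ~ A w -> forall n, `|\sum_(k < n) b k w * g k w|
     <= u + s ^+ 2 / 2 * \sum_(k < n) b k w ^+ 2.
Proof.
move=> mb; have mNb k : measurable_on H0 (\- b k) by apply: measurable_funN; exact: mb.
have [A mA [PA hA]] := ville mb u; have [B mB [PB hB]] := ville mNb u.
exists (A `|` B); first exact: measurableU.
split.
  apply: le_trans (measureU2 P mA mB) _.
  by rewrite mulr_natl mulr2n EFinD; exact: leeD.
move=> w /not_orP[nA nB] n; rewrite ler_norml hA// andbT.
have := hB w nB n; under eq_bigr do rewrite /= mulNr.
rewrite sumrN; under [X in _ * X]eq_bigr do rewrite /= sqrrN.
lra.
Qed.

Let inv_pair (q : nat) : R := (q.+1%:R * q.+2%:R)^-1.

Let sum_inv_pair n : \sum_(q < n) inv_pair q = 1 - n.+1%:R^-1.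
Proof.
elim: n => [|n IH]; first by rewrite big_ord0 invr1 subrr.
rewrite big_ord_recr/= IH /inv_pair -[n.+2%:R]natr1.
have h1 : n.+1%:R != 0 :> R by rewrite pnatr_eq0.
have h2 : n.+1%:R + 1 != 0 :> R by rewrite natr1 pnatr_eq0.
by move: n.+1%:R h1 h2 => x h1 h2; field; rewrite ?h1 ?h2.
Qed.

(* At the level ln ((q + 1) (q + 2)) + m the exceptional sets have probabilities
   2 e^(-m) / ((q + 1) (q + 2)), which sum to 2 e^(-m) over q. *)
Lemma ae_sum_bound (b : nat -> nat -> Omega -> R) :
  (forall q k, measurable_on H0 (b q k)) ->
  {ae P, forall w, exists c : R, 0 <= c /\ forall q n,
    `|\sum_(k < n) b q k w * g k w|
      <= ln (q.+1%:R * q.+2%:R) + c + s ^+ 2 / 2 * \sum_(k < n) b q k w ^+ 2}.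
Proof.
move=> mb.
have /choice[A hA] : forall z : nat * nat, exists A : set Omega,
    [/\ measurable A, (P A <= (2 * expR (- z.2%:R) * inv_pair z.1)%:E)%E &
    forall w, ~ A w -> forall n, `|\sum_(k < n) b z.1 k w * g k w|
     <= ln (z.1.+1%:R * z.1.+2%:R) + z.2%:R + s ^+ 2 / 2 * \sum_(k < n) b z.1 k w ^+ 2].
  move=> [q m]/=.
  have [A mA [PA h]] := @ville_abs (b q) (ln (q.+1%:R * q.+2%:R) + m%:R) (mb q).
  exists A; split => //; apply: le_trans PA _.
  rewrite lee_fin opprD expRD -mulrA [expR (- m%:R) * _]mulrC.
  by rewrite [expR (- ln _)]expRN lnK// posrE mulr_gt0.
pose B m := \bigcup_q A (q, m).
have mB m : measurable (B m).
  by apply: bigcupT_measurable => q; have [] := hA (q, m).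
have PB m : (P (B m) <= (2 * expR (- m%:R))%:E)%E.
  apply: (@le_trans _ _ (\sum_(q <oo) P (A (q, m)))%E).
    by apply: measure_sigma_subadditive => // q; have [] := hA (q, m).
  apply: lime_le; first by apply: is_cvg_nneseries => *; exact: measure_ge0.
  apply: nearW => n; apply: (@le_trans _ _ (\sum_(0 <= q < n) (2 * expR (- m%:R) * inv_pair q)%:E)%E).
    by apply: lee_sum => q _; have [] := hA (q, m).
  rewrite sumEFin lee_fin -mulr_sumr big_mkord sum_inv_pair.
  by rewrite ler_piMr ?mulr_ge0 ?expR_ge0// lerBlDr lerDl.
(* P (B m) <= 2 e^(-m) makes the intersection null. Outside it some m is good for all q
   simultaneously, and this m is the constant c. *)
exists (\bigcap_m B m); split.
- exact: bigcapT_measurable.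
- apply/eqP; rewrite eq_le measure_ge0 andbT.
  have PN m : (P (\bigcap_m B m) <= (2 * expR (- 1) ^+ m)%:E)%E.
    apply: le_trans (le_measure _ _ _ (bigcap_inf (i := m) _)) _ => //.
    + by rewrite inE; exact: bigcapT_measurable.
    + by rewrite inE; exact: mB.
    + by apply: le_trans (PB m) _; rewrite -expRM_natl mulrN1.
  have fP : P (\bigcap_m B m) \is a fin_num by exact/fin_num_measure/bigcapT_measurable.
  rewrite -(fineK fP) lee_fin.
  apply: (@le_add_geometric _ _ _ 2 (expR (- 1))).
  + exact: expR_ge0.
  + by rewrite -[ltRHS]expR0 ltr_expR; lra.
  + by move=> m; rewrite add0r -lee_fin fineK.
- move=> w /= nw m _; apply: contrapT => nB; apply: nw.
  exists m%:R; split => // q n.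
  by have [_ _] := hA (q, m); apply => Aw; apply: nB; exists q.
Qed.

End exponential_supermartingale.

(** * Laws and almost sure summability *)

Section density.
Context d (T : measurableType d) (R : realType).
Variables (mu nu : {measure set T -> \bar R}) (p : T -> R).
Hypotheses (p_ge0 : forall x, 0 <= p x) (mp : measurable_fun setT p).
Hypothesis nuE : forall A, measurable A -> nu A = (\int[mu]_(x in A) (p x)%:E)%E.
Local Open Scope ereal_scope.

Import HBNNSimple.

Let integral_density_nnsfun (h : {nnsfun T >-> R}) :
  \int[nu]_x (h x)%:E = \int[mu]_x ((h x)%:E * (p x)%:E).
Proof.
transitivity (\int[nu]_x
   (\sum_(y \in range h) (y * \1_(h @^-1` [set y]) x)%:E)).
  by apply: eq_integral => t _; rewrite /= fimfunE -fsumEFin.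
rewrite ge0_integral_fsum//; last 2 first.
- by move=> r; apply/measurable_EFinP; exact: measurable_funM.
- by move=> m y _; exact: nnfun_muleindic_ge0.
transitivity (\int[mu]_x (\sum_(y \in range h)
    (y * \1_(h @^-1` [set y]) x)%:E * (p x)%:E)); last first.
  apply: eq_integral => x _.
  rewrite -ge0_mule_fsuml => [|y]; last exact: nnfun_muleindic_ge0.
  by rewrite fsumEFin // -(fimfunE _ x).
have mp' : measurable_fun setT (EFin \o p) by exact/measurable_EFinP.
rewrite ge0_integral_fsum//; last 2 first.
- move=> y; apply: emeasurable_funM => //.
  by apply/measurable_EFinP; exact: measurable_funM.
- by move=> m y _; rewrite mule_ge0 ?nnfun_muleindic_ge0// lee_fin.
apply: eq_fsbigr => r rhn.
under [LHS]eq_integral do rewrite EFinM.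
rewrite integralZl_indic_nnsfun => //.
under [RHS]eq_integral do rewrite EFinM -muleA.
rewrite ge0_integralZl//.
- under [in RHS]eq_integral do rewrite muleC.
  rewrite [in RHS](eq_integral ((EFin \o p) \_ (h @^-1` [set r]))); last first.
    by move=> x xE; rewrite epatch_indic.
  by rewrite -integral_mkcondr setTI -nuE// integral_indic// setIT.
- by apply: emeasurable_funM => //; exact/measurable_EFinP.
- by move=> t Et; rewrite mule_ge0 ?lee_fin.
- by move: rhn; rewrite inE => -[t _ <-]; rewrite lee_fin.
Qed.

(** The identity for sets extends to simple functions by linearity, then to f by monotone
    convergence on both sides. *)
Lemma ge0_integral_density (f : T -> \bar R) :
  measurable_fun setT f -> (forall x, 0 <= f x) ->
  \int[nu]_x f x = \int[mu]_x (f x * (p x)%:E).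
Proof.
move=> mf f0.
pose h := nnsfun_approx measurableT mf.
have fE x : f x = lim ((EFin \o h n) x @[n --> \oo]).
  by apply/esym/cvg_lim => //; exact: cvg_nnsfun_approx.
transitivity (lim (\int[nu]_x (EFin \o h n) x @[n --> \oo])).
  under eq_integral do rewrite fE.
  apply: monotone_convergence => //.
  - by move=> n; exact/measurable_EFinP.
  - by move=> n x _ //=; rewrite lee_fin.
  - by move=> x _ a b ab; rewrite lee_fin; exact/lefP/nd_nnsfun_approx.
have fg x : f x * (p x)%:E = lim (((EFin \o h n) x * (p x)%:E) @[n --> \oo]).
  by apply/esym/cvg_lim => //; apply: cvgeZr => //; exact: cvg_nnsfun_approx.
under [RHS]eq_integral do rewrite fg.
rewrite monotone_convergence//.
- by under eq_fun do rewrite integral_density_nnsfun.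
- by move=> n; apply/emeasurable_funM; exact/measurable_EFinP.
- by move=> n x _ /=; rewrite mule_ge0 ?lee_fin.
- by move=> x _ a b ab/=; rewrite lee_wpmul2r ?lee_fin//; exact/lefP/nd_nnsfun_approx.
Qed.

End density.

Lemma expectation_density d (Omega : measurableType d) (R : realType)
    (P : probability Omega R) d' (T : measurableType d')
    (mu : {measure set T -> \bar R}) (p : T -> R) (X : Omega -> T)
    (f : T -> \bar R) :
  (forall x, 0 <= p x) -> measurable_fun setT p -> measurable_fun setT X ->
  (forall A, measurable A -> P (X @^-1` A) = (\int[mu]_(x in A) (p x)%:E)%E) ->
  measurable_fun setT f -> (forall x, (0 <= f x)%E) ->
  (\int[P]_w f (X w) = \int[mu]_x (f x * (p x)%:E))%E.
Proof.
move=> p0 mp mX PX mf f0.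
pose X' : {mfun Omega >-> T} := HB.pack X (isMeasurableFun.Build _ _ _ _ _ mX).
rewrite -[LHS](@ge0_integral_distribution _ _ _ _ _ P X' f mf f0).
exact: ge0_integral_density.
Qed.

Section laws.
Context d (Omega : measurableType d) (R : realType) (P : probability Omega R).
Variable X : Omega -> R.
Hypothesis mX : measurable_fun setT X.

(** Completing the square: the exponential factor turns the centered normal density into the one
    with mean s^2 x and the same deviation s, which integrates to 1. *)
Lemma normal_mgf (s x : R) : 0 < s ->
  (forall A, measurable A -> P (X @^-1` A) = normal_prob 0 s A) ->
  (\int[P]_w (expR (x * X w - s ^+ 2 / 2 * x ^+ 2))%:E = 1)%E.
Proof.
move=> s0 PX; have s1 : s != 0 by rewrite gt_eqF.
have mf : measurable_fun setT (fun y => (expR (x * y - s ^+ 2 / 2 * x ^+ 2))%:E).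
  apply/measurable_EFinP; apply: measurableT_comp => //; exact: measurable_funB.
rewrite (expectation_density (mu := @lebesgue_measure R) (normal_pdf_ge0 0 s) (measurable_normal_pdf 0 s)
  mX PX mf (fun y => expR_ge0 _)).
rewrite -(integral_normal_pdf (s ^+ 2 * x) s); apply: eq_integral => y _.
rewrite -EFinM !normal_pdfE//; congr EFin.
rewrite mulrCA; congr (_ * _).
rewrite /normal_fun -expRD; congr expR.
by field; rewrite s1.
Qed.

(** The product of e^(-y) with the density of rate 1 is half the density of rate 2. *)
Lemma exponential_laplace :
  (forall A, measurable A -> P (X @^-1` A) = exponential_prob 1 A) ->
  (\int[P]_w (expR (- X w))%:E = (2^-1)%:E)%E.
Proof.
move=> PX.
have mf : measurable_fun setT (fun y : R => (expR (- y))%:E).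
  by apply/measurable_EFinP; apply: measurableT_comp => //; exact: measurableT_comp.
rewrite (expectation_density (mu := @lebesgue_measure R) (exponential_pdf_ge0 ler01)
  (measurable_exponential_pdf 1) mX PX mf (fun y => expR_ge0 _)).
transitivity (\int[lebesgue_measure]_x ((2^-1)%:E * (exponential_pdf 2 x)%:E : \bar R))%E.
  apply: eq_integral => y _; rewrite -!EFinM; congr EFin.
  have [y0|y0] := leP 0 y; last by rewrite !lt0_exponential_pdf// !mulr0.
  rewrite !exponential_pdfE//= [RHS]mulrA mulVf// !mul1r -expRD; congr expR.
  by ring.
rewrite ge0_integralZl//.
- by rewrite integral_exponential_pdf// mule1.
- by apply/measurable_EFinP; exact: measurable_exponential_pdf.
- by move=> y _; rewrite lee_fin exponential_pdf_ge0.
Qed.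

End laws.

Section ae_summable.
Context d (Omega : measurableType d) (R : realType) (P : probability Omega R).

Lemma ae_summable (X : nat -> Omega -> R) (q : nat -> R) (C : R) :
  (forall k, measurable_fun setT (X k)) -> (forall k w, 0 <= X k w) ->
  (forall k, (\int[P]_w (X k w)%:E <= (q k)%:E)%E) ->
  (forall n, \sum_(k < n) q k <= C) ->
  {ae P, forall w, exists B, forall n, \sum_(k < n) X k w <= B}.
Proof.
move=> mX X0 Xq qC.
pose Y w := (\sum_(k <oo) (X k w)%:E)%E.
have mXE k : measurable_fun setT (fun w => (X k w)%:E) by exact/measurable_EFinP.
have Y0 w : (0 <= Y w)%E by apply: nneseries_ge0 => k _ _; rewrite lee_fin.
have mY : measurable_fun setT Y by apply: ge0_emeasurable_sum => // k w _ _; rewrite lee_fin.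
have IY : (\int[P]_w Y w <= C%:E)%E.
  rewrite integral_nneseries//; last by move=> k w _; rewrite lee_fin.
  apply: lime_le; first by apply: is_cvg_nneseries => k _ _; apply: integral_ge0 => w _; rewrite lee_fin.
  apply: nearW => n; apply: (@le_trans _ _ (\sum_(0 <= k < n) (q k)%:E)%E).
    by apply: lee_sum => k _.
  by rewrite sumEFin lee_fin big_mkord.
have iY : P.-integrable setT Y.
  apply/integrableP; split => //; under eq_integral do rewrite gee0_abs//.
  by rewrite (le_lt_trans IY)// ltry.
have := integrable_ae measurableT iY; apply: filterS => w /(_ I) fY.
exists (fine (Y w)) => n; rewrite -lee_fin fineK// -sumEFin -(big_mkord xpredT (fun k => (X k w)%:E)).
by apply: nneseries_lim_ge => k _ _; rewrite lee_fin.
Qed.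

End ae_summable.

(** * Measurability of continuous functions in space and time *)

Section grid.
Variable R : realType.

Definition grid_floor (n : nat) (u : R) : R :=
  (Num.floor (n.+1%:R * u))%:~R / n.+1%:R.

Lemma grid_floor_ge0 n u : 0 <= u -> 0 <= grid_floor n u.
Proof.
by move=> u0; rewrite divr_ge0// ler0z floor_ge0 mulr_ge0.
Qed.

Lemma grid_floor_dist n u : `|u - grid_floor n u| <= n.+1%:R^-1.
Proof.
have n0 : 0 < n.+1%:R :> R by [].
have /andP[h1 h2] := floor_itv (n.+1%:R * u).
have e : u - grid_floor n u = (n.+1%:R * u - (Num.floor (n.+1%:R * u))%:~R) / n.+1%:R.
  by rewrite /grid_floor mulrBl mulrAC divff ?mul1r// gt_eqF.
rewrite e ger0_norm; last by rewrite divr_ge0// subr_ge0.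
rewrite ler_pdivrMr// mulVf ?gt_eqF// lerBlDl.
by move: h2; rewrite intrD => /ltW.
Qed.

Lemma grid_floor_cvg u : grid_floor ^~ u @ \oo --> u.
Proof.
apply/cvgrPdist_le => e e0.
have := near_infty_natSinv_lt (PosNum e0); apply: filterS => n /= h.
by apply: le_trans (grid_floor_dist n u) _; exact: ltW.
Qed.

Local Notation space := ((R * R) * R)%type.

Definition grid3 n (p : space) : space :=
  ((grid_floor n p.1.1, grid_floor n p.1.2), grid_floor n p.2).

(* [f \o grid3 n] is constant on each of countably many measurable cells. *)
Lemma measurable_comp_grid3 n (f : space -> R) :
  measurable_fun setT (f \o grid3 n).
Proof.
move=> _ B mB; rewrite setTI.
pose cell (k : int * int * int) : set space := [set p |
  [/\ Num.floor (n.+1%:R * p.1.1) = k.1.1, Num.floor (n.+1%:R * p.1.2) = k.1.2 &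
      Num.floor (n.+1%:R * p.2) = k.2]].
pose val (k : int * int * int) : space :=
  ((k.1.1%:~R / n.+1%:R, k.1.2%:~R / n.+1%:R), k.2%:~R / n.+1%:R).
have -> : (f \o grid3 n) @^-1` B =
    \bigcup_(k in [set: int * int * int]) (if `[< B (f (val k)) >] then cell k else set0).
  apply/seteqP; split => p.
    move=> /= Bp; exists (Num.floor (n.+1%:R * p.1.1), Num.floor (n.+1%:R * p.1.2),
       Num.floor (n.+1%:R * p.2)) => //=.
    by rewrite ifT//; apply/asboolP.
  move=> [[[k1 k2] k3] _]; case: ifPn => // /asboolP Bk [/= e1 e2 e3].
  by rewrite /grid3 /grid_floor e1 e2 e3.
apply: countable_bigcupT_measurable => [|[[k1 k2] k3]]; first exact: countableP.
case: ifPn => // _.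
have mfl (h : space -> R) k : measurable_fun setT h ->
    measurable [set p | Num.floor (n.+1%:R * h p) = k].
  move=> mh; have -> : [set p | Num.floor (n.+1%:R * h p) = k] =
      setT `&` (fun p => n.+1%:R * h p) @^-1` `[k%:~R, (k + 1)%:~R[.
    apply/seteqP; split => p /=; rewrite in_itv/=.
      by move=> <-; split => //; exact: floor_itv.
    by move=> [_ h1]; exact: floor_def.
  have mh' : measurable_fun setT (fun p => n.+1%:R * h p) by exact: measurable_funM.
  exact: mh'.
have -> : cell ((k1, k2), k3) = [set p | Num.floor (n.+1%:R * p.1.1) = k1] `&`
   ([set p | Num.floor (n.+1%:R * p.1.2) = k2] `&` [set p | Num.floor (n.+1%:R * p.2) = k3]).
  by apply/seteqP; split => p /= => [[]|[? []]].
have m1 : measurable_fun setT (fun p : space => p.1.1) by apply: measurableT_comp.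
have m2 : measurable_fun setT (fun p : space => p.1.2) by apply: measurableT_comp.
have m3 : measurable_fun setT (fun p : space => p.2) by exact: measurable_snd.
by apply: measurableI; [exact: mfl m1|apply: measurableI; [exact: mfl m2|exact: mfl m3]].
Qed.

Lemma grid3_cvg p : grid3 ^~ p @ \oo --> p.
Proof.
case: p => [[p1 p2] p3]; have h := grid_floor_cvg.
apply: (@cvg_pair _ _ _ \oo (nbhs (p1, p2)) (nbhs p3)); last exact: h.
by apply: (@cvg_pair _ _ _ \oo (nbhs p1) (nbhs p2)); exact: h.
Qed.

(** On A the function is the pointwise limit of the step functions [f \o grid3 n]. Continuity is
    only relative to A, so the approximating points must stay in A; the half-space of nonnegative
    times qualifies because nonnegative numbers are rounded down to nonnegative ones. *)
Lemma within_continuous_measurable3 (A : set space) (f : space -> R) :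
  (forall p n, A p -> A (grid3 n p)) ->
  {within A, continuous f} -> measurable_fun A f.
Proof.
move=> Agrid /subspace_continuousP cf.
apply: (@measurable_fun_cvg _ _ _ _ (fun n => f \o grid3 n)).
  by move=> n; apply: measurable_funTS; exact: measurable_comp_grid3.
move=> p Ap; apply: cvg_comp (cf p Ap) => U wU.
have h : \forall n \near \oo, A (grid3 n p) -> U (grid3 n p) := @grid3_cvg p _ wU.
change (\forall n \near \oo, U (grid3 n p)).
by apply: filterS h => n; apply; exact: Agrid.
Qed.

Lemma continuous_measurable2 (f : R * R -> R) :
  continuous f -> measurable_fun setT f.
Proof.
move=> cf.
have mf : measurable_fun setT (fun p : space => f p.1).
  apply: within_continuous_measurable3 => //.
  apply/subspace_continuousP => p _; apply: cvg_within_filter.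
  by apply: (@cvg_comp _ _ _ fst f _ (nbhs p.1)); [exact: cvg_fst|exact: cf].
have -> : f = (fun p : space => f p.1) \o (fun y => (y, 0)) by [].
by apply: measurableT_comp => //; exact: measurable_pair2.
Qed.

End grid.

(** * The wave kernel *)

Section improper_FTC.
Variable R : realType.
Notation mu := (@lebesgue_measure R).

(** The integrand may blow up at e, where only the primitive is continuous. The interval is
    exhausted from the left, with monotone convergence for the integrals and continuity of F for
    their values. *)
Lemma ge0_FTC_at_left (f F : R -> R) (p e : R) : p < e ->
  (forall u, p <= u -> u < e -> 0 <= f u) ->
  (forall u, u < e -> {for u, continuous f}) ->
  continuous F -> (forall u : R, u < e -> is_derive u 1 F (f u)) ->
  (\int[mu]_(u in `[p, e[) (f u)%:E = (F e - F p)%:E)%E.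
Proof.
move=> pe f0 cf cF dF.
(* With n + 2 in the denominator, already q 0 lies strictly to the right of p. *)
pose q (n : nat) := e - (e - p) / n.+2%:R.
have ep : 0 < e - p by rewrite subr_gt0.
have qe n : q n < e by rewrite /q ltrBlDr ltrDl divr_gt0.
have pq n : p < q n.
  by rewrite /q ltrBrDr -ltrBrDl ltr_pdivrMr// ltr_pMr// ltr1n.
have qcvg : q @ \oo --> e.
  rewrite -[X in _ --> X]subr0; apply: cvgB; first exact: cvg_cst.
  rewrite -[X in _ --> X](mulr0 (e - p)).
  apply: (@cvgM _ _ _ _ (cst (e - p)) (fun n => n.+2%:R^-1)); first exact: cvg_cst.
  have -> : (fun n => n.+2%:R^-1) = (fun n => @harmonic R n.+1) by [].
  by rewrite (cvg_shiftS (@harmonic R)); exact: cvg_harmonic.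
have cfq n : {within `[p, q n], continuous f}.
  apply: continuous_in_subspaceT => u; rewrite inE/= in_itv/= => /andP[_ uq].
  by apply: cf; apply: le_lt_trans uq (qe n).
have Iq n : (\int[mu]_(u in `[p, q n]) (f u)%:E = (F (q n) - F p)%:E)%E.
  rewrite (@continuous_FTC2 _ f F)//.
  - split.
    + move=> u; rewrite in_itv/= => /andP[_ uq].
      by have [] := dF u (lt_trans uq (qe n)).
    + exact/cvg_at_right_filter/cF.
    + exact/cvg_at_left_filter/cF.
  - move=> u; rewrite in_itv/= => /andP[_ uq].
    by have := dF u (lt_trans uq (qe n)) => d; rewrite derive1E; exact: derive_val.
have e1 : `[p, e[%classic = \bigcup_n `[p, q n]%classic.
  apply/seteqP; split => u /=; rewrite in_itv/=.
    move=> /andP[pu ue].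
    have : \forall n \near \oo, u < q n by apply: cvgr_gt qcvg _ ue.
    move=> [n _ /(_ n (leqnn n)) h]; exists n => //=.
    by rewrite in_itv/= pu ltW.
  move=> [n _] /=; rewrite in_itv/= => /andP[-> uq]/=.
  exact: le_lt_trans uq (qe n).
have lim1 : (\int[mu]_(u in `[p, q n]) (f u)%:E)%E @[n --> \oo] -->
    (\int[mu]_(u in `[p, e[) (f u)%:E)%E.
  rewrite e1; apply: ge0_nondecreasing_set_cvg_integral.
  - move=> m n mn; apply/subsetPset => u /=; rewrite !in_itv/= => /andP[-> uq]/=.
    apply: le_trans uq _; rewrite /q lerB// ler_pM2l// lef_pV2 ?posrE// ler_nat.
    by rewrite !ltnS.
  - by move=> n; exact: measurable_itv.
  - move=> n; apply/measurable_EFinP; apply: subspace_continuous_measurable_fun => //.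
  - move=> n u /=; rewrite in_itv/= => /andP[pu uq]; rewrite lee_fin f0//.
    exact: le_lt_trans uq (qe n).
rewrite -(cvg_lim _ lim1)//; apply: cvg_lim => //.
rewrite (_ : (fun n => _) = (fun n => (F (q n) - F p)%:E)); last by apply/funext.
apply: cvg_EFin; first exact: nearW.
apply: cvgB; last exact: cvg_cst.
by apply: continuous_cvg => //; exact: cF.
Qed.

End improper_FTC.

(** * Differences of inverse square roots *)

Section inverse_sqrt_product.
Variable R : realType.
Implicit Types v c : R.

Let k c v : R := (Num.sqrt (v * (v + c)))^-1.
Let w v : R := (Num.sqrt v)^-1.

Lemma inv_sqrt_prod_le c v : 0 < c -> 0 < v -> k c v <= w c * w v.
Proof.
move=> c0 v0; rewrite /k /w -invfM -sqrtrM; last exact: ltW.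
have h1 : 0 < c * v by rewrite mulr_gt0.
have h2 : 0 < v * (v + c) by rewrite mulr_gt0// addr_gt0.
rewrite lef_pV2 ?posrE ?sqrtr_gt0//.
by rewrite ler_wsqrtr// mulrC ler_pM2l// lerDr ltW.
Qed.

Lemma inv_sqrt_prod_noninc c v v' : 0 < c -> 0 < v -> v <= v' -> k c v' <= k c v.
Proof.
move=> c0 v0 vv'; have v0' := lt_le_trans v0 vv'.
have h1 : 0 < v' * (v' + c) by rewrite mulr_gt0// addr_gt0.
have h2 : 0 < v * (v + c) by rewrite mulr_gt0// addr_gt0.
rewrite /k lef_pV2 ?posrE ?sqrtr_gt0//.
by rewrite ler_wsqrtr// ler_pM ?lerD2r ?(ltW v0)// addr_ge0 ?ltW.
Qed.

(** Reduces a difference of kernels to one of inverse square roots, which has an elementary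
    primitive. Write N, P, Q for the roots of c, v, v + c. The product rule splits the difference
    into two terms, each at most N^(-1) (P^(-1) - P'^(-1)), whence the factor 2: the first because Q
    >= N, the second because also Q' >= P and Q' - Q <= P' - P, by concavity of the root. *)
Lemma inv_sqrt_prod_diff c v v' : 0 < c -> 0 < v -> v <= v' ->
  k c v - k c v' <= 2 * w c * (w v - w v').
Proof.
move=> c0 v0 vv'; have v0' := lt_le_trans v0 vv'.
have vc0 : 0 < v + c by rewrite addr_gt0.
have vc0' : 0 < v' + c by rewrite addr_gt0.
rewrite /k /w (sqrtrM _ (ltW v0)) (sqrtrM _ (ltW v0')).
have sN : 0 < Num.sqrt c by rewrite sqrtr_gt0.
have sP : 0 < Num.sqrt v by rewrite sqrtr_gt0.
have sP' : 0 < Num.sqrt v' by rewrite sqrtr_gt0.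
have sQ : 0 < Num.sqrt (v + c) by rewrite sqrtr_gt0.
have sQ' : 0 < Num.sqrt (v' + c) by rewrite sqrtr_gt0.
have PP' : Num.sqrt v <= Num.sqrt v' by rewrite ler_wsqrtr.
have PQ : Num.sqrt v <= Num.sqrt (v + c) by rewrite ler_wsqrtr// lerDl ltW.
have PQ' : Num.sqrt v' <= Num.sqrt (v' + c) by rewrite ler_wsqrtr// lerDl ltW.
have NQ : Num.sqrt c <= Num.sqrt (v + c) by rewrite ler_wsqrtr// lerDr ltW.
have QQ' : Num.sqrt (v + c) <= Num.sqrt (v' + c) by rewrite ler_wsqrtr// lerD2r.
have key : (Num.sqrt (v' + c) - Num.sqrt (v + c)) * (Num.sqrt (v' + c) + Num.sqrt (v + c))
  = (Num.sqrt v' - Num.sqrt v) * (Num.sqrt v' + Num.sqrt v).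
  by rewrite -!subr_sqr !sqr_sqrtr ?ltW//; ring.
move: (Num.sqrt c) (Num.sqrt v) (Num.sqrt v') (Num.sqrt (v + c)) (Num.sqrt (v' + c))
  sN sP sP' sQ sQ' PP' PQ PQ' NQ QQ' key => N P P' Q Q' {vc0 vc0' v0 v0' vv' c0 v v'}.
move=> N0 P0 P0' Q0 Q0' PP' PQ PQ' NQ QQ' key.
have d1 : Q' - Q <= P' - P.
  have s0 : 0 < Q' + Q by rewrite addr_gt0.
  by rewrite -(ler_pM2r s0) key ler_wpM2l ?subr_ge0// lerD// (le_trans PQ).
have iQN : Q^-1 <= N^-1 by rewrite lef_pV2.
have iPd : 0 <= P^-1 - P'^-1 by rewrite subr_ge0 lef_pV2.
have t1 : (P^-1 - P'^-1) * Q^-1 <= (P^-1 - P'^-1) * N^-1 by rewrite ler_wpM2l.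
have t2 : P'^-1 * (Q^-1 - Q'^-1) <= (P^-1 - P'^-1) * N^-1.
  have -> : Q^-1 - Q'^-1 = (Q' - Q) * (Q^-1 * Q'^-1).
    by field; rewrite !gt_eqF.
  have -> : P^-1 - P'^-1 = P'^-1 * ((P' - P) * P^-1).
    by field; rewrite !gt_eqF.
  rewrite -mulrA ler_pM2l ?invr_gt0// -mulrA.
  have iQ'P : Q'^-1 <= P^-1 by rewrite lef_pV2 ?posrE// (le_trans PP').
  have iQ0 : 0 <= Q^-1 by rewrite invr_ge0 ltW.
  have iQ0' : 0 <= Q'^-1 by rewrite invr_ge0 ltW.
  apply: ler_pM => //; first by rewrite subr_ge0.
    by rewrite mulr_ge0.
  by rewrite mulrC ler_pM.
have -> : (P * Q)^-1 - (P' * Q')^-1 =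
    (P^-1 - P'^-1) * Q^-1 + P'^-1 * (Q^-1 - Q'^-1) by rewrite !invfM; ring.
by apply: le_trans (lerD t1 t2) _; rewrite le_eqVlt; apply/orP; left; apply/eqP; ring.
Qed.

End inverse_sqrt_product.

Lemma measurable_sqrtr (R : realType) : measurable_fun setT (@Num.sqrt R).
Proof. exact: continuous_measurable_fun (@sqrt_continuous R). Qed.

Lemma measurable_sqrtrV (R : realType) :
  measurable_fun setT (fun x : R => (Num.sqrt x)^-1 : R).
Proof.
have -> : (fun x : R => (Num.sqrt x)^-1 : R) = (fun x => x `^ (-1)) \o Num.sqrt.
  by apply/funext => x /=; rewrite powR_inv1.
by apply: measurableT_comp; [exact: measurable_powR|exact: measurable_sqrtr].
Qed.

(** * Time increments of the retarded integral at a fixed position *)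

Section wave_kernel.
Variable R : realType.
Notation mu := (@lebesgue_measure R).
Variables (a c M : R) (sig : R -> R).
Hypotheses (a_gt0 : 0 < a) (c_gt0 : 0 < c).
Hypotheses (sig_meas : measurable_fun setT sig) (sigM : forall u, `|sig u| <= M).

Let w (e u : R) : R := (Num.sqrt (a * (e - u)))^-1.

(* With e = t - r / a and c = 2 r one has
   a^2 (t - u)^2 - r^2 = a (e - u) (a (e - u) + c). *)
Definition wave_weight (e u : R) : R :=
  if (0 <= u) && (u < e) then (Num.sqrt (a * (e - u) * (a * (e - u) + c)))^-1 else 0.

Let m : R := (Num.sqrt c)^-1.

Let m_ge0 : 0 <= m. Proof. by rewrite invr_ge0. Qed.

Let M_ge0 : 0 <= M. Proof. exact: le_trans (normr_ge0 _) (sigM 0). Qed.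

Let w_ge0 e u : 0 <= w e u. Proof. by rewrite invr_ge0. Qed.

Let arg_gt0 (e u : R) : u < e -> 0 < a * (e - u).
Proof. by move=> ue; rewrite mulr_gt0// subr_gt0. Qed.

Let arg_le (e e' u : R) : e <= e' -> a * (e - u) <= a * (e' - u).
Proof. by move=> ee'; rewrite ler_pM2l// lerB. Qed.

Let w_noninc e e' u : u < e -> e <= e' -> w e' u <= w e u.
Proof.
move=> ue ee'; rewrite /w lef_pV2 ?posrE ?sqrtr_gt0 ?arg_gt0//.
  by rewrite ler_wsqrtr// arg_le.
exact: lt_le_trans ue ee'.
Qed.

Lemma wave_weight_ge0 e u : 0 <= wave_weight e u.
Proof. by rewrite /wave_weight; case: ifP => // _; rewrite invr_ge0. Qed.


Let mw e : measurable_fun setT (w e).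
Proof.
have mf : measurable_fun setT (fun u : R => a * (e - u)).
  by apply: measurable_funM => //; exact: measurable_funB.
exact: (measurableT_comp (@measurable_sqrtrV R) mf).
Qed.

Lemma measurable_wave_weight e : measurable_fun setT (wave_weight e).
Proof.
apply: measurable_fun_ifT => //.
  apply: measurable_and; first exact: measurable_fun_ler.
  exact: measurable_fun_ltr.
have ml : measurable_fun setT (fun u : R => a * (e - u)).
  by apply: measurable_funM => //; exact: measurable_funB.
have mf : measurable_fun setT (fun u : R => a * (e - u) * (a * (e - u) + c)).
  by apply: measurable_funM => //; exact: measurable_funD.
exact: (measurableT_comp (@measurable_sqrtrV R) mf).
Qed.

Let sqrt_comp_continuous e : continuous (fun u : R => Num.sqrt (a * (e - u))).
Proof.
move=> u; apply: (@continuous_comp _ _ _ (fun u : R => a * (e - u)) Num.sqrt).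
  apply: cvgM; first exact: cvg_cst.
  by apply: cvgB; [exact: cvg_cst|exact: cvg_id].
exact: sqrt_continuous.
Qed.

Let w_continuous e u : u < e -> {for u, continuous (w e)}.
Proof.
move=> ue; apply: cvgV; last exact: sqrt_comp_continuous.
by rewrite gt_eqF// sqrtr_gt0 arg_gt0.
Qed.

Let F e (u : R) := - (2 / a) * Num.sqrt (a * (e - u)).

Let F_continuous e : continuous (F e).
Proof.
move=> u; apply: cvgM; first exact: cvg_cst.
exact: sqrt_comp_continuous.
Qed.

Let F_derive e (u : R) : u < e -> is_derive u 1 (F e) (w e u).
Proof.
move=> ue; have v0 := arg_gt0 ue.
have d1 : is_derive u 1 (fun u : R => a * (e - u)) (- a).
  have d0 := is_deriveZ a (is_deriveB (is_derive_cst e u 1) (is_derive_id u 1)).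
  by apply: is_derive_eq d0 _; rewrite sub0r /GRing.scale/= mulrN1.
have d2 := @is_derive1_comp R Num.sqrt (fun u : R => a * (e - u)) u _ _
  (is_derive1_sqrt v0) d1.
have d3 := is_deriveZ (- (2 / a)) d2.
apply: is_derive_eq d3 _.
rewrite /w /GRing.scale/=; field.
by rewrite !gt_eqF// sqrtr_gt0.
Qed.

Let integral_w p e : p < e ->
  (\int[mu]_(u in `[p, e[) (w e u)%:E = (2 / a * Num.sqrt (a * (e - p)))%:E)%E.
Proof.
move=> pe; rewrite (ge0_FTC_at_left (F := F e) pe (fun u _ _ => w_ge0 e u)
  (@w_continuous e) (@F_continuous e) (@F_derive e)).
by rewrite /F subrr mulr0 sqrtr0 mulr0 sub0r mulNr opprK.
Qed.

(** The boundary terms at p have a favourable sign and are dropped; the one at e is the square root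
    of the time shift. *)
Let integral_w_diff p e e' : p < e -> e <= e' ->
  (\int[mu]_(u in `[p, e[) (w e u - w e' u)%:E <=
   (2 / a * Num.sqrt (a * (e' - e)))%:E)%E.
Proof.
move=> pe ee'.
have wd0 u : p <= u -> u < e -> 0 <= w e u - w e' u.
  by move=> _ ue; rewrite subr_ge0 w_noninc.
have wdc u : u < e -> {for u, continuous (fun u => w e u - w e' u)}.
  move=> ue; apply: cvgB; first exact: w_continuous.
  exact/w_continuous/(lt_le_trans ue).
have Fdc : continuous (fun u => F e u - F e' u).
  by move=> u; apply: cvgB; exact: F_continuous.
have Fdd (u : R) : u < e -> is_derive u 1 (fun u => F e u - F e' u) (w e u - w e' u).
  move=> ue; apply: is_deriveB; first exact: F_derive.
  exact/F_derive/(lt_le_trans ue).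
rewrite (ge0_FTC_at_left pe wd0 wdc Fdc Fdd).
rewrite lee_fin /F subrr mulr0 sqrtr0 mulr0 sub0r.
have a2 : 0 <= 2 / a by rewrite divr_ge0// ltW.
have : 2 / a * Num.sqrt (a * (e - p)) <= 2 / a * Num.sqrt (a * (e' - p)).
  by rewrite ler_wpM2l// ler_wsqrtr// arg_le.
lra.
Qed.

(* Both summands have explicit primitives, whose square roots telescope; no
   regularity of [sig] is needed since [e |-> wave_weight e u] is monotone. *)
Let dom (e e' u : R) : R :=
  ((fun u => 2 * m * (w e u - w e' u)) \_ `[0, e[) u +
  ((fun u => m * w e' u) \_ `[Num.max 0 e, e'[) u.

Let dom1_ge0 e e' u : e <= e' ->
  0 <= ((fun u => 2 * m * (w e u - w e' u)) \_ `[0, e[) u.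
Proof.
move=> ee'; rewrite patchE; case: ifPn => //; rewrite inE/= in_itv/= => /andP[_ ue].
by rewrite mulr_ge0 ?mulr_ge0// subr_ge0 w_noninc.
Qed.

Let dom2_ge0 e e' u : 0 <= ((fun u => m * w e' u) \_ `[Num.max 0 e, e'[) u.
Proof. by rewrite patchE; case: ifPn => // _; rewrite mulr_ge0. Qed.

(** Before e both weights are present and only their difference counts; between e and e' the later
    one stands alone. *)
Let weight_diff_le e e' u : e <= e' ->
  `|wave_weight e' u - wave_weight e u| <= dom e e' u.
Proof.
move=> ee'; rewrite /dom.
have d1 := @dom1_ge0 e e' u ee'; have d2 := @dom2_ge0 e e' u.
have [u0|u0] := ltP u 0.
  by rewrite /wave_weight (lt_geF u0)/= subrr normr0 addr_ge0.
have [ue|ue] := ltP u e.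
  have ue' := lt_le_trans ue ee'.
  apply: (@le_trans _ _ (2 * m * (w e u - w e' u))); last first.
    rewrite [X in _ <= X + _]patchE ifT ?lerDl//.
    by rewrite inE/= in_itv/= u0 ue.
  rewrite /wave_weight u0 ue ue'/= distrC ger0_norm.
    by apply: inv_sqrt_prod_diff => //; [exact: arg_gt0|exact: arg_le].
  by rewrite subr_ge0; apply: inv_sqrt_prod_noninc => //; [exact: arg_gt0|exact: arg_le].
rewrite {2}/wave_weight (le_gtF ue) andbF subr0.
rewrite ger0_norm ?wave_weight_ge0// /wave_weight u0/=.
have [ue'|ue'] := ltP u e'; last by rewrite addr_ge0.
apply: (@le_trans _ _ (m * w e' u)).
  by apply: inv_sqrt_prod_le => //; exact: arg_gt0.
rewrite [X in _ <= _ + X]patchE ifT ?lerDr//.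
by rewrite inE/= in_itv/= ue' ge_max u0 ue.
Qed.

Let itv_restrict_integral (f : R -> R) p q : measurable_fun setT f ->
  (\int[mu]_u ((f \_ `[p, q[) u)%:E = \int[mu]_(u in `[p, q[) (f u)%:E)%E.
Proof.
move=> mf; rewrite [RHS]integral_mkcond; apply: eq_integral => u _.
by rewrite !patchE; case: ifP.
Qed.

(** The constant is 6 = 2 * 2 + 2, with 2 / a from each primitive and the factor 2 from
    [inv_sqrt_prod_diff]. Times e <= 0, before the wave arrives, are treated apart since the first
    interval is then empty. *)
Lemma integral_weight_diff e e' : e <= e' ->
  (\int[mu]_u `|wave_weight e' u - wave_weight e u|%:E <=
   (6 / a * m * Num.sqrt (a * (e' - e)))%:E)%E.
Proof.
move=> ee'.
have mA1 : measurable_fun setT (fun u => 2 * m * (w e u - w e' u)).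
  by apply: measurable_funM => //; exact: measurable_funB.
have mA2 : measurable_fun setT (fun u => m * w e' u) by exact: measurable_funM.
have mD1 : measurable_fun setT ((fun u => 2 * m * (w e u - w e' u)) \_ `[0, e[).
  by apply/(measurable_restrictT _ (measurable_itv _)); exact: measurable_funTS.
have mD2 : measurable_fun setT ((fun u => m * w e' u) \_ `[Num.max 0 e, e'[).
  by apply/(measurable_restrictT _ (measurable_itv _)); exact: measurable_funTS.
apply: (@le_trans _ _ (\int[mu]_u (dom e e' u)%:E)%E).
  apply: ge0_le_integral => //.
  - apply/measurable_EFinP; apply: measurableT_comp => //.
    by apply: measurable_funB; exact: measurable_wave_weight.
  - by apply/measurable_EFinP; exact: measurable_funD.
  - by move=> u _; rewrite lee_fin weight_diff_le.
rewrite (_ : (fun u => _) = (fun u =>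
   (((fun u => 2 * m * (w e u - w e' u)) \_ `[0, e[) u)%:E +
   (((fun u => m * w e' u) \_ `[Num.max 0 e, e'[) u)%:E)%E)//.
rewrite ge0_integralD//; last 4 first.
- by move=> u _; rewrite lee_fin dom1_ge0.
- exact/measurable_EFinP.
- by move=> u _; rewrite lee_fin.
- exact/measurable_EFinP.
rewrite !itv_restrict_integral//.
have a2 : 0 <= 2 / a by rewrite divr_ge0// ltW.
have -> : 6 / a * m * Num.sqrt (a * (e' - e)) =
  2 * m * (2 / a * Num.sqrt (a * (e' - e))) + m * (2 / a * Num.sqrt (a * (e' - e))) by ring.
rewrite EFinD; apply: leeD.
  have [e0|e0] := ltP 0 e; last first.
    rewrite set_itv_ge ?integral_set0 ?bnd_simp -?leNgt// lee_fin.
    by rewrite !mulr_ge0 ?invr_ge0 ?(ltW a_gt0).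
  under eq_integral do rewrite EFinM.
  rewrite ge0_integralZl//.
  + rewrite [leRHS]EFinM; apply: lee_wpmul2l; first by rewrite lee_fin mulr_ge0.
    exact: integral_w_diff.
  + by apply/measurable_EFinP/measurable_funTS; apply: measurable_funB; exact: mw.
  + by move=> u /=; rewrite in_itv/= => /andP[_ ue]; rewrite lee_fin subr_ge0 w_noninc.
  + by rewrite lee_fin mulr_ge0.
have [pe|pe] := ltP (Num.max 0 e) e'; last first.
  rewrite set_itv_ge ?integral_set0 ?bnd_simp -?leNgt// lee_fin.
  by rewrite !mulr_ge0 ?invr_ge0 ?(ltW a_gt0).
under eq_integral do rewrite EFinM.
rewrite ge0_integralZl//.
+ rewrite integral_w// -EFinM lee_fin ler_wpM2l// ler_wpM2l// ler_wsqrtr//.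
  by rewrite ler_pM2l// lerB// le_max lexx orbT.
+ by apply/measurable_EFinP/measurable_funTS; exact: mw.
+ by move=> u _; rewrite lee_fin.
Qed.

Definition wave_integral e := Rintegral mu setT (fun u => sig u * wave_weight e u).

(** The weight with e replaced by [Num.min 0 e] is identically zero, so integrability is an instance
    of the increment bound. *)
Lemma wave_integrable e :
  mu.-integrable setT (EFin \o (fun u => sig u * wave_weight e u)).
Proof.
have e0 : Num.min 0 e <= e by rewrite ge_min lexx orbT.
have ww0 u : wave_weight (Num.min 0 e) u = 0.
  by rewrite /wave_weight lt_min; case: (leP 0 u) => //= u0; rewrite ltNge u0.
apply/integrableP; split.
  apply/measurable_EFinP; apply: measurable_funM => //; exact: measurable_wave_weight.
apply: (@le_lt_trans _ _ (\int[mu]_u (M%:E * `|wave_weight e u - wave_weight (Num.min 0 e) u|%:E))%E).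
  apply: ge0_le_integral => //.
  - apply: measurableT_comp => //; apply/measurable_EFinP; apply: measurable_funM => //.
    exact: measurable_wave_weight.
  - apply: measurable_funeM; apply/measurable_EFinP; apply: measurableT_comp => //.
    by apply: measurable_funB; exact: measurable_wave_weight.
  - by move=> u _ /=; rewrite lee_fin ww0 subr0 normrM ler_wpM2r.
rewrite ge0_integralZl//; last first.
  apply/measurable_EFinP; apply: measurableT_comp => //.
  by apply: measurable_funB; exact: measurable_wave_weight.
apply: le_lt_trans (lee_wpmul2l _ (integral_weight_diff e0)) _.
  by rewrite lee_fin.
by rewrite -EFinM ltry.
Qed.

Lemma wave_integral_increment e e' : e <= e' ->
  `|wave_integral e' - wave_integral e| <= 6 / a * M * m * Num.sqrt (a * (e' - e)).
Proof.
move=> ee'; rewrite /wave_integral -RintegralB//; [|exact: wave_integrable..].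
have mW := measurable_wave_weight.
have iB : mu.-integrable setT (EFin \o (fun u => sig u * wave_weight e' u - sig u * wave_weight e u)).
  exact: (integrableB measurableT (wave_integrable e') (wave_integrable e)).
apply: le_trans (le_normr_Rintegral _ iB) _ => //.
rewrite -lee_fin /Rintegral fineK; last first.
  apply: integrable_fin_num => //.
  exact: (integrable_norm iB).
apply: (@le_trans _ _ (\int[mu]_u (M%:E * `|wave_weight e' u - wave_weight e u|%:E))%E).
  apply: ge0_le_integral => //.
  - apply/measurable_EFinP; apply: measurableT_comp => //.
    by apply: measurable_funB; apply: measurable_funM => //; exact: mW.
  - apply: measurable_funeM; apply/measurable_EFinP; apply: measurableT_comp => //.
    by apply: measurable_funB; exact: mW.
  - by move=> u _ /=; rewrite lee_fin -mulrBr normrM ler_wpM2r.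
rewrite ge0_integralZl//; last first.
  by apply/measurable_EFinP; apply: measurableT_comp => //; apply: measurable_funB; exact: mW.
apply: le_trans (lee_wpmul2l _ (integral_weight_diff ee')) _.
  by rewrite lee_fin.
by rewrite -EFinM lee_fin le_eqVlt; apply/orP; left; apply/eqP; ring.
Qed.

End wave_kernel.

(** * Regularity of the kernel in time and measurability in space *)

Section Gker.
Variable R : realType.
Notation mu := (@lebesgue_measure R).
Variables (a M : R) (sigma : R * R -> R -> R).
Hypotheses (a_gt0 : 0 < a).
Hypothesis sigma_cont : {within [set p : (R * R) * R | 0 <= p.2],
  continuous (fun p => sigma p.1 p.2)}.
Hypothesis sigmaM : forall y t, 0 <= t -> `|sigma y t| <= M.

Lemma dist2C (x y : R * R) : dist2 x y = dist2 y x.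
Proof. by rewrite /dist2 -sqrrN opprB -[(x.2 - _) ^+ 2]sqrrN opprB. Qed.

Lemma dist2_ge0 (x y : R * R) : 0 <= dist2 x y.
Proof. exact: sqrtr_ge0. Qed.

Let M_ge0 : 0 <= M. Proof. exact: le_trans (normr_ge0 _) (sigmaM (0, 0) (lexx 0)). Qed.

(** Nothing is assumed of [sigma] at negative times, which the kernel never sees; this extension is
    bounded and measurable everywhere. *)
Definition sigma_ext (p : (R * R) * R) : R := if 0 <= p.2 then sigma p.1 p.2 else 0.

Lemma sigma_ext_le p : `|sigma_ext p| <= M.
Proof. by rewrite /sigma_ext; case: ifP => p2; [exact: sigmaM|rewrite normr0]. Qed.

Lemma measurable_sigma_ext : measurable_fun setT sigma_ext.
Proof.
have m2 : measurable_fun setT (fun p : (R * R) * R => p.2) by exact: measurable_snd.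
apply: measurable_fun_if => //.
- exact: measurable_fun_ler.
- rewrite setTI; have -> : (fun p : (R * R) * R => 0 <= p.2) @^-1` [set true] =
    [set p | 0 <= p.2] by [].
  apply: within_continuous_measurable3 => // p n; exact: grid_floor_ge0.
Qed.

Lemma Gker_wave x y t : 0 < dist2 x y ->
  Gker a sigma x y t = (2 * pi * a)^-1 *
    wave_integral a (2 * dist2 x y) (fun u => sigma_ext (y, u)) (t - dist2 x y / a).
Proof.
move=> r0; rewrite /Gker /wave_integral /Rintegral [dist2 y x]dist2C.
move: (dist2 x y) r0 => r r0; case: ltP => rt; last first.
  have e0 : t - r / a <= 0 by rewrite subr_le0 ler_pdivlMr// mulrC.
  rewrite (_ : (fun u => _) = cst 0%E) ?integral0 ?mulr0//.
  apply/funext => u /=; rewrite /wave_weight; case: ifP => [/andP[u0 ue]|_]; last by rewrite mulr0.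
  by have := lt_le_trans ue e0; rewrite ltNge u0.
congr (_ * fine _); rewrite [LHS]integral_mkcond; apply: eq_integral => u _.
rewrite patchE /wave_weight; case: ifPn.
  rewrite inE/= in_itv/= => /andP[u0 ue]; rewrite /sigma_ext /= u0/=.
  (* At u = e the radicand vanishes and [0^-1] is 0, so the closed interval in [Gker] agrees with
     the half-open support of [wave_weight]. *)
  move: ue; rewrite le_eqVlt => /orP[/eqP->|ue].
    rewrite ltxx mulr0; congr EFin.
    rewrite (_ : _ - r ^+ 2 = 0) ?sqrtr0 ?invr0 ?mulr0//.
    by field; rewrite gt_eqF.
  rewrite ue; congr (EFin (_ * (Num.sqrt _)^-1)).
  by field; rewrite gt_eqF.
rewrite notin_setE/= in_itv/= => /negP; rewrite negb_and.
case: (leP 0 u) => //= u0; last by rewrite mulr0.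
by rewrite -ltNge => ue; rewrite (lt_gtF ue) mulr0.
Qed.

(** The prefactor of Poisson's formula times the bound of [wave_integral_increment]; the root of 2
    comes from c = 2 r, the root of a from the time shift a (t - s). *)
Definition Gker_const := (2 * pi * a)^-1 * (6 / a * M) * Num.sqrt a / Num.sqrt 2.

Lemma Gker_const_ge0 : 0 <= Gker_const.
Proof.
rewrite /Gker_const mulr_ge0// ?invr_ge0// mulr_ge0// mulr_ge0//.
  by rewrite invr_ge0 mulr_ge0 ?mulr_ge0 ?pi_ge0// ltW.
by rewrite mulr_ge0// divr_ge0// ltW.
Qed.

Lemma Gker_increment x y s t : 0 < dist2 x y ->
  `|Gker a sigma x y t - Gker a sigma x y s| <=
    Gker_const / Num.sqrt (dist2 x y) * Num.sqrt `|t - s|.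
Proof.
move=> r0.
wlog st : s t / s <= t => [hw|].
  have [st|/ltW ts] := leP s t; first exact: hw.
  by rewrite distrC [`|t - s|]distrC; exact: hw.
rewrite !Gker_wave// -mulrBr normrM ger0_norm; last first.
  by rewrite invr_ge0 mulr_ge0 ?mulr_ge0 ?pi_ge0// ltW.
have mS : measurable_fun setT (fun u => sigma_ext (y, u)).
  by apply: (measurableT_comp measurable_sigma_ext); exact: measurable_pair1.
have r2 : 0 < 2 * dist2 x y by rewrite mulr_gt0.
have ee : s - dist2 x y / a <= t - dist2 x y / a by rewrite lerB.
have := wave_integral_increment a_gt0 r2 mS (fun u => sigma_ext_le (y, u)) ee.
rewrite (_ : _ - _ - (_ - _) = t - s); last by ring.
rewrite (ger0_norm (x := t - s)) ?subr_ge0// => h.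
have c0 : 0 <= (2 * pi * a)^-1 by rewrite invr_ge0 mulr_ge0 ?mulr_ge0 ?pi_ge0// ltW.
apply: le_trans (ler_wpM2l c0 h) _.
rewrite /Gker_const (sqrtrM _ (ltW a_gt0)).
rewrite (_ : (Num.sqrt (2 * dist2 x y))^-1 = (Num.sqrt 2)^-1 / Num.sqrt (dist2 x y)).
  2: by rewrite sqrtrM// invfM.
move: (2 * pi * a)^-1 (Num.sqrt a) (Num.sqrt 2)^-1 (Num.sqrt (dist2 x y))^-1.
move=> c1 c2 c3 c4.
by rewrite le_eqVlt; apply/orP; left; apply/eqP; ring.
Qed.

Lemma Gker_eq0 x y t : a * t <= dist2 x y -> Gker a sigma x y t = 0.
Proof. by rewrite /Gker ltNge => ->. Qed.

Lemma measurable_dist2 (x : R * R) : measurable_fun setT (dist2 x).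
Proof.
have m1 : measurable_fun setT (fun y : R * R => y.1) by exact: measurable_fst.
have m2 : measurable_fun setT (fun y : R * R => y.2) by exact: measurable_snd.
have mf : measurable_fun setT (fun y : R * R => (x.1 - y.1) ^+ 2 + (x.2 - y.2) ^+ 2).
  by apply: measurable_funD; apply: measurable_funX; exact: measurable_funB.
exact: (measurableT_comp (@measurable_sqrtr R) mf).
Qed.

Lemma measurable_Gker x t : measurable_fun setT (fun y => Gker a sigma x y t).
Proof.
(* The interval of integration depends on y; writing it as a cutoff makes the integrand jointly
   measurable. As h is signed, its positive and negative parts are integrated separately. *)
pose h (p : (R * R) * R) : R :=
  if (0 <= p.2) && (p.2 <= t - dist2 x p.1 / a) then
    sigma_ext p / Num.sqrt (a ^+ 2 * (t - p.2) ^+ 2 - dist2 p.1 x ^+ 2) else 0.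
have mp2 : measurable_fun setT (fun p : (R * R) * R => p.2) by exact: measurable_snd.
have md : measurable_fun setT (fun p : (R * R) * R => dist2 x p.1).
  by apply: measurableT_comp => //; exact: measurable_dist2.
have mrad : measurable_fun setT
    (fun p : (R * R) * R => a ^+ 2 * (t - p.2) ^+ 2 - dist2 p.1 x ^+ 2).
  apply: measurable_funB.
    by apply: measurable_funM => //; apply: measurable_funX; exact: measurable_funB.
  apply: measurable_funX.
  by rewrite (_ : (fun p => _) = fun p : (R * R) * R => dist2 x p.1)//;
    apply/funext => p; rewrite dist2C.
have mh : measurable_fun setT h.
  apply: measurable_fun_ifT => //.
    apply: measurable_and; first exact: measurable_fun_ler.
    apply: measurable_fun_ler => //; apply: measurable_funB => //.
    exact: measurable_funM.
  apply: measurable_funM; first exact: measurable_sigma_ext.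
  exact: (measurableT_comp (@measurable_sqrtrV R) mrad).
pose I y := (\int[mu]_u (h (y, u))%:E)%E.
have mI : measurable_fun setT I.
  have mh' : measurable_fun setT (EFin \o h) by exact/measurable_EFinP.
  rewrite (_ : I = fun y => (\int[mu]_u (EFin \o h)^\+ (y, u) - \int[mu]_u (EFin \o h)^\- (y, u))%E).
    apply: emeasurable_funB.
      by apply: measurable_fun_fubini_tonelli_F => //; exact: measurable_funepos.
    by apply: measurable_fun_fubini_tonelli_F => //; exact: measurable_funeneg.
  by apply/funext => y; rewrite /I [LHS]integralE; congr (_ - _)%E; apply: eq_integral => u _; rewrite ?funeposE ?funenegE.
have -> : (fun y => Gker a sigma x y t) =
    (fun y => if dist2 x y < a * t then (2 * pi * a)^-1 * fine (I y) else 0).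
  apply/funext => y; rewrite /Gker; case: ifP => // _; congr (_ * fine _).
  rewrite [LHS]integral_mkcond; apply: eq_integral => u _.
  rewrite patchE /h/=; case: ifPn => [|].
    by rewrite inE/= in_itv/= => /[dup] /andP[u0 _] ->; rewrite /sigma_ext/= u0.
  by rewrite notin_setE/= in_itv/= => /negP/negbTE ->.
apply: measurable_fun_ifT => //.
  by apply: measurable_fun_ltr; [exact: measurable_dist2|exact: measurable_cst].
apply: measurable_funM => //.
by apply: measurableT_comp => //; exact: fine_measurable.
Qed.

End Gker.

(** * Weighted series *)

Section weighted_series.
Variable R : realType.
Variables (T c : R) (v : nat -> R) (f : nat -> R -> R) (L : nat -> R).
Hypotheses (T_gt0 : 0 < T) (c_ge0 : 0 <= c).
Hypotheses (v_gt0 : forall k, 0 < v k) (v_dec : forall k, v k.+1 <= v k).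
Hypothesis v_cvg0 : v @ \oo --> 0.
Hypothesis f_at0 : forall k, f k 0 = 0.
Hypothesis f_sqrt : forall k s t, 0 <= s <= T -> 0 <= t <= T ->
  `|f k t - f k s| <= L k * Num.sqrt `|t - s|.

Let Y n t := \sum_(k < n) f k t / v k.

Hypothesis Y_dyadic : forall n m i, (i < 2 ^ m)%N ->
  `|Y n (T * (i.+1%:R / 2 ^+ m)) - Y n (T * (i%:R / 2 ^+ m))|
    <= Num.sqrt (T / 2 ^+ m) * (2 * m%:R + c).

Let Y_sqrt n s t : 0 <= s <= T -> 0 <= t <= T ->
  `|Y n t - Y n s| <= (\sum_(k < n) L k / v k) * Num.sqrt `|t - s|.
Proof.
move=> sT tT; rewrite /Y -sumrB mulr_suml.
apply: le_trans (ler_norm_sum _ _ _) _; apply: ler_sum => k _.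
rewrite -mulrBl normrM (ger0_norm (x := (v k)^-1)) ?invr_ge0 ?(ltW (v_gt0 k))//.
by rewrite mulrAC ler_wpM2r ?invr_ge0 ?(ltW (v_gt0 k))// f_sqrt.
Qed.

Let Y_hoelder beta : 0 < beta -> beta < 1 / 2 -> exists2 C, 0 <= C &
  forall n s t, 0 <= s <= T -> 0 <= t <= T ->
    `|Y n t - Y n s| <= C * `|t - s| `^ beta.
Proof.
move=> b0 b2; have [C C0 hC] := dyadic_chaining R T beta T_gt0 b0.
pose q : R := Num.sqrt 2^-1; pose th : R := 2^-1 `^ beta.
have q0 : 0 < q by rewrite sqrtr_gt0.
have qth : q < th.
  rewrite /q -powR12_sqrt// /th /powR gt_eqF// ltr_expR ltr_nM2r ?ln_lt0//; last by lra.
  by rewrite -div1r.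
have sT : 0 <= Num.sqrt T by [].
pose K := 2 * Num.sqrt T * (q / (th - q)) + Num.sqrt T * c.
have hK m : (2 * Num.sqrt T * m%:R + Num.sqrt T * c) * q ^+ m <= K * th ^+ m.
  by apply: affine_expr_le => //; rewrite mulr_ge0.
have K0 : 0 <= K.
  have d0 : 0 <= q / (th - q) by rewrite divr_ge0 ?(ltW q0)// subr_ge0 ltW.
  by apply: addr_ge0; rewrite mulr_ge0// mulr_ge0.
exists (C * K); first by rewrite mulr_ge0.
move=> n; apply: (hC (Y n) K (\sum_(k < n) L k / v k) K0); first exact: Y_sqrt.
move=> m i im; apply: le_trans (Y_dyadic n im) _; apply: le_trans (hK m).
have -> : Num.sqrt (T / 2 ^+ m) = Num.sqrt T * q ^+ m.
  rewrite sqrtrM ?(ltW T_gt0)//; congr (_ * _); rewrite /q -exprVn.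
  by elim: m {im hK} => [|m IH]; rewrite ?expr0 ?sqrtr1// !exprS sqrtrM ?invr_ge0// IH.
by rewrite le_eqVlt; apply/orP; left; apply/eqP; ring.
Qed.

Let partial_sum n t : \sum_(k < n) f k t = \sum_(k < n) v k * (Y k.+1 t - Y k t).
Proof.
apply: eq_bigr => k _; rewrite /Y big_ord_recr/= addrAC subrr add0r mulrC divfK//.
by rewrite gt_eqF.
Qed.

Lemma weighted_series_hoelder : exists U : R -> R,
  (forall t, 0 <= t <= T -> (fun n => \sum_(k < n) f k t) @ \oo --> U t) /\
  (forall beta, 0 < beta -> beta < 1 / 2 -> hoelder_on T beta U).
Proof.
have v_ge0 k : 0 <= v k by exact: ltW.
have T01 : 0 <= (0 : R) <= T by rewrite lexx ltW.
have Y0 t : Y 0%N t = 0 by rewrite /Y big_ord0.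
have Yat0 n : Y n 0 = 0.
  by rewrite /Y big1// => k _; rewrite f_at0 mul0r.
have ex t : 0 <= t <= T -> cvgn (fun n => \sum_(k < n) f k t).
  (* Any exponent below 1/2 would do: since Y n vanishes at time 0, its Hoelder bound there bounds Y
     n t uniformly in n. *)
  move=> tT; have [C C0 hC] := Y_hoelder (beta := 1 / 4) ltac:(lra) ltac:(lra).
  under eq_fun do rewrite partial_sum.
  apply: (sum_by_parts_cvg R v (Y ^~ t) (C * `|t| `^ (1 / 4))) => // n.
  by have := hC n 0 t T01 tT; rewrite Yat0 !subr0.
exists (fun t => lim ((fun n => \sum_(k < n) f k t) @ \oo)); split => [//|beta b0 b2].
have [C C0 hC] := Y_hoelder b0 b2.
exists (C * v 0%N) => s t sT tT.
rewrite -limB; [|exact: ex..].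
have cB : cvgn (fun n => \sum_(k < n) f k t - \sum_(k < n) f k s).
  by apply: is_cvgB; exact: ex.
rewrite -lim_norm//; apply: limr_le; first exact: is_cvg_norm.
apply: nearW => n; change (`|\sum_(k < n) f k t - \sum_(k < n) f k s| <= C * v 0%N * `|t - s| `^ beta).
rewrite !partial_sum -sumrB.
under eq_bigr do rewrite -mulrBr.
have := sum_by_parts_le R v (fun n => Y n t - Y n s) (C * `|t - s| `^ beta) v_ge0 v_dec _ _ n.
rewrite !Y0 subr0 => /(_ erefl (fun n => hC n s t sT tT)).
rewrite [C * v 0%N * _]mulrAC; apply: le_trans.
rewrite le_eqVlt; apply/orP; left; apply/eqP; congr `|_|.
by apply: eq_bigr => k _; ring.
Qed.

End weighted_series.

(** * Arrival times *)

Section preimages.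
Context d d' (Omega : measurableType d) (T : measurableType d').
Variable X : Omega -> T.

Lemma preimg_sets_setI : setI_closed (preimg_sets X).
Proof.
move=> _ _ [A mA ->] [B mB ->]; exists (A `&` B); first exact: measurableI.
by rewrite preimage_setI.
Qed.

Lemma preimg_sets_setT : preimg_sets X setT.
Proof. by exists setT. Qed.

Lemma preimg_sets_measurable A :
  measurable_fun setT X -> preimg_sets X A -> measurable A.
Proof. by move=> mX [B mB ->]; rewrite -[X in measurable X]setTI; exact: mX. Qed.

End preimages.

Section arrival_times.
Context d (Omega : measurableType d) (R : realType) (P : probability Omega R).
Variables (I : eqType) (F : I -> set (set Omega)).
Hypothesis F_setI : forall i, setI_closed (F i).
Hypothesis F_setT : forall i, F i setT.
Hypothesis F_measurable : forall i A, F i A -> measurable A.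
Hypothesis F_indep : mutually_independent P F.
Variables (j : nat -> I) (E : nat -> Omega -> R).
Hypothesis j_inj : injective j.
Hypothesis E_F : forall k B, measurable B -> F (j k) (E k @^-1` B).
Hypothesis E_law : forall k A, measurable A -> P (E k @^-1` A) = exponential_prob 1 A.

(** This sum has k terms and starts at 0, whereas in [lepage_setting] the sum of index k has k + 1
    terms. *)
Let Gam k w := \sum_(i < k) E i w.

Let past (n : nat) : pred I := fun i => i \in [seq j k | k <- iota 0 n].

Let past_notin n : ~~ past n (j n).
Proof.
apply/negP => /mapP[k].
by rewrite mem_iota => /andP[_ kn] /j_inj nk; move: kn; rewrite -nk ltnn.
Qed.

Let past_in k n : (k < n)%N -> past n (j k).
Proof. by move=> kn; apply/mapP; exists k => //; rewrite mem_iota/= add0n. Qed.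

Let E_meas k : measurable_fun setT (E k).
Proof. by move=> _ B mB; rewrite setTI; exact: F_measurable (E_F k mB). Qed.

Let Gam_meas n : measurable_fun setT (Gam n).
Proof. by apply: measurable_sum => k; exact: E_meas. Qed.

Lemma arrival_laplace n : (\int[P]_w (expR (- Gam n w))%:E = (2^-1 ^+ n)%:E)%E.
Proof.
elim: n => [|n IH].
  under eq_integral do rewrite /Gam big_ord0 oppr0 expR0.
  by rewrite integral_cst//= mul1e probability_setT expr0.
pose f (z : R * R) : \bar R := (expR (- z.1) * expR (- z.2))%:E.
have mf : measurable_fun setT f.
  have m1 : measurable_fun setT (fun z : R * R => expR (- z.1)).
    by apply: measurableT_comp => //; apply: measurableT_comp => //; exact: measurable_fst.
  have m2 : measurable_fun setT (fun z : R * R => expR (- z.2)).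
    by apply: measurableT_comp => //; apply: measurableT_comp => //; exact: measurable_snd.
  by apply/measurable_EFinP; exact: measurable_funM.
have mG : measurable_wrt F (past n) (Gam n).
  have mE (k : 'I_n) : measurable_wrt F (past n) (E k).
    exact: measurable_wrt_gen (past_in (ltn_ord k)) (E_F k).
  rewrite /Gam; exact: measurable_sum.
transitivity (\int[P]_w f (Gam n w, E n w))%E.
  by apply: eq_integral => w _; rewrite /f/= -expRD -opprD /Gam big_ord_recr.
rewrite (indep_integral F_setI F_setT F_measurable F_indep (past_notin n) mG (E_F n))//; last first.
  by move=> z; rewrite lee_fin mulr_ge0 ?expR_ge0.
transitivity (\int[P]_w ((2^-1)%:E * (expR (- Gam n w))%:E))%E.
  apply: eq_integral => w _; rewrite /f/=.
  under eq_integral do rewrite EFinM.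
  rewrite ge0_integralZl//.
  - by rewrite (exponential_laplace (E_meas n) (@E_law n)) muleC.
  - by apply/measurable_EFinP; apply: measurableT_comp => //; exact: measurableT_comp.
rewrite ge0_integralZl//.
- by rewrite IH -EFinM -exprS.
- by apply/measurable_EFinP; apply: measurableT_comp => //; exact: measurableT_comp.
Qed.

(** A substitute for the law of large numbers. The variables (3/2)^k e^(-Gam k) have the summable
    means (3/4)^k, so almost surely they are bounded, and Gam k >= k ln (3/2) - O(1). Halving the
    slope absorbs the constant for large k. *)
Lemma arrival_growth : exists2 c : R, 0 < c &
  {ae P, forall w, exists k0, forall k, (k0 <= k)%N -> c * k%:R <= Gam k w}.
Proof.
have l0 : 0 < ln (3 / 2 : R) by rewrite ln_gt0//; lra.
exists (ln (3 / 2) / 2); first by rewrite divr_gt0.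
pose X k w := (3 / 2) ^+ k * expR (- Gam k w).
have mX k : measurable_fun setT (X k).
  apply: measurable_funM => //; apply: measurableT_comp => //; exact: measurableT_comp.
have X0 k w : 0 <= X k w by rewrite mulr_ge0 ?expR_ge0// exprn_ge0.
have EX k : (\int[P]_w (X k w)%:E <= ((3 / 4) ^+ k)%:E)%E.
  under eq_integral do rewrite EFinM.
  rewrite ge0_integralZl//; last first.
    by apply/measurable_EFinP; apply: measurableT_comp => //; exact: measurableT_comp.
  rewrite arrival_laplace -EFinM -exprMn lee_fin.
  by rewrite (_ : 3 / 2 / 2 = 3 / 4 :> R)//; lra.
have sumX n : \sum_(k < n) (3 / 4 : R) ^+ k <= 4.
  have -> : \sum_(k < n) (3 / 4 : R) ^+ k = 4 * (1 - (3 / 4) ^+ n).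
    elim: n => [|n IH]; first by rewrite big_ord0 expr0 subrr mulr0.
    by rewrite big_ord_recr/= IH exprS; lra.
  by rewrite ler_piMr// lerBlDr lerDl exprn_ge0.
have := ae_summable mX X0 EX sumX; apply: filterS => w [B hB].
have XB k : X k w <= B.
  apply: le_trans (hB k.+1); rewrite big_ord_recr/= lerDr.
  by apply: sumr_ge0 => i _.
pose B' := Num.max B 1; have B'0 : 0 < B' by rewrite lt_max ltr01 orbT.
have hG k : ln (3 / 2) * k%:R <= Gam k w + ln B'.
  have h : X k w <= B' by rewrite le_max XB.
  have p0 : 0 < (3 / 2 : R) ^+ k by rewrite exprn_gt0.
  have : ln (X k w) <= ln B' by rewrite ler_ln ?posrE// mulr_gt0 ?expR_gt0.
  rewrite /X lnM ?posrE ?expR_gt0// expRK lnXn//.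
  by rewrite -mulr_natr; lra.
exists (Num.trunc (2 * ln B' / ln (3 / 2))).+1 => k hk.
have hk' : 2 * ln B' / ln (3 / 2) <= k%:R.
  apply: ltW; apply: lt_le_trans (truncnS_gt _) _.
  by rewrite ler_nat.
rewrite ler_pdivrMr// in hk'.
by have := hG k; lra.
Qed.

End arrival_times.

(** * Positions *)

Section positions.
Variable R : realType.
Variable phi : R * R -> R.
Hypotheses (phi_cont : continuous phi) (phi_gt0 : forall y, 0 < phi y).
Variable x : R * R.

(** Squares replace discs: as products of segments they have immediate area and compactness. *)
Definition square (rho : R) : set (R * R) :=
  `[x.1 - rho, x.1 + rho]%classic `*` `[x.2 - rho, x.2 + rho]%classic.

Lemma measurable_square rho : measurable (square rho).
Proof. by apply: measurableX; exact: measurable_itv. Qed.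

Lemma dist2_square y rho : dist2 x y <= rho -> square rho y.
Proof.
move=> h; have rho0 : 0 <= rho := le_trans (dist2_ge0 x y) h.
have h2 : (x.1 - y.1) ^+ 2 + (x.2 - y.2) ^+ 2 <= rho ^+ 2.
  rewrite -(@sqr_sqrtr _ ((x.1 - y.1) ^+ 2 + (x.2 - y.2) ^+ 2)) ?addr_ge0 ?sqr_ge0//.
  by rewrite ler_sqr ?nnegrE// sqrtr_ge0.
have q1 := sqr_ge0 (x.1 - y.1); have q2 := sqr_ge0 (x.2 - y.2).
have n1 : `|x.1 - y.1| <= rho.
  by rewrite -ler_sqr ?nnegrE// real_normK ?num_real//; lra.
have n2 : `|x.2 - y.2| <= rho.
  by rewrite -ler_sqr ?nnegrE// real_normK ?num_real//; lra.
move: n1 n2; rewrite !ler_norml => /andP[? ?] /andP[? ?].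
by split; rewrite /= in_itv/=; apply/andP; split; lra.
Qed.

Lemma square_sub rho rho' : rho <= rho' -> square rho `<=` square rho'.
Proof.
move=> rr y [/= h1 h2]; rewrite in_itv/= in h1; rewrite in_itv/= in h2.
by split; rewrite /= in_itv/=; apply/andP; split; lra.
Qed.

Lemma square0 : square 0 = [set x].
Proof.
apply/seteqP; split => [[y1 y2]|_ ->].
  move=> [/= h1 h2]; rewrite in_itv/= subr0 addr0 in h1; rewrite in_itv/= subr0 addr0 in h2.
  by move: x h1 h2 => [x1 x2]/= h1 h2; rewrite (le_anti h1) (le_anti h2).
by split; rewrite /= in_itv/= subr0 addr0 lexx.
Qed.

Let compact_square rho : compact (square rho).
Proof. by apply: compact_setX; exact: segment_compact. Qed.

Let square_nonempty rho : 0 <= rho -> square rho !=set0.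
Proof. by move=> r0; exists x; split; rewrite /= in_itv/=; apply/andP; split; lra. Qed.

Lemma density_square_ub rho : 0 <= rho ->
  exists2 B, 0 < B & forall y, square rho y -> phi y <= B.
Proof.
move=> r0; have := @compact_EVT_max _ _ phi (square rho) (square_nonempty r0) (@compact_square rho).
have cf : {within square rho, continuous phi} by exact: continuous_subspaceT.
move=> /(_ cf)[z _ hz]; exists (phi z) => // y sy; apply: hz.
by rewrite inE.
Qed.

Lemma density_square_lb rho : 0 <= rho ->
  exists2 b, 0 < b & forall y, square rho y -> b <= phi y.
Proof.
move=> r0; have := @compact_EVT_min _ _ phi (square rho) (square_nonempty r0) (@compact_square rho).
have cf : {within square rho, continuous phi} by exact: continuous_subspaceT.
move=> /(_ cf)[z _ hz]; exists (phi z) => // y sy; apply: hz.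
by rewrite inE.
Qed.

Lemma leb2_square rho : 0 <= rho -> leb2 (square rho) = ((2 * rho) ^+ 2)%:E.
Proof.
move=> r0; rewrite /leb2 /square product_measure1E; [|exact: measurable_itv..].
have len (z : R) : lebesgue_measure `[z - rho, z + rho]%classic = (2 * rho)%:E.
  rewrite lebesgue_measure_itv/= lte_fin.
  have [->|r1] := eqVneq rho 0; first by rewrite subr0 addr0 ltxx mulr0.
  have rp : 0 < rho by rewrite lt_neqAle eq_sym r1.
  by rewrite ifT; [rewrite -EFinD; congr EFin; ring|lra].
by rewrite expr2 EFinM; congr (_ * _)%E; exact: len.
Qed.

Context d (Omega : measurableType d) (P : probability Omega R).
Variable rho0 : R.
Hypothesis rho0_gt0 : 0 < rho0.

Definition has_density (X : Omega -> R * R) := measurable_fun setT X /\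
  forall A, measurable A -> P (X @^-1` A) = (\int[leb2]_(y in A) (phi y)%:E)%E.

Lemma square_prob : exists2 B, 0 <= B & forall X, has_density X ->
  forall rho, 0 <= rho -> rho <= rho0 ->
    (P (X @^-1` square rho) <= (B * rho ^+ 2)%:E)%E.
Proof.
have [B B0 hB] := density_square_ub (ltW rho0_gt0).
exists (4 * B); first by rewrite mulr_ge0// ltW.
move=> X [mX lX] rho r0 rr0; rewrite lX; last exact: measurable_square.
apply: (@le_trans _ _ (\int[leb2]_(y in square rho) B%:E)%E).
  apply: ge0_le_integral => //.
  - exact: measurable_square.
  - by move=> y _; rewrite lee_fin ltW.
  - by apply/measurable_EFinP/measurable_funTS; exact: continuous_measurable2.
  - move=> y [h1 h2]; rewrite lee_fin; apply: hB; move: h1 h2.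
    by move=> h1 h2; apply: square_sub rr0 _ (conj h1 h2).
rewrite (_ : (\int[leb2]_(y in square rho) B%:E)%E = (B * (2 * rho) ^+ 2)%:E); last first.
  rewrite EFinM integral_cst; last exact: measurable_square.
  by congr (_ * _)%E; exact: leb2_square.
by rewrite lee_fin le_eqVlt; apply/orP; left; apply/eqP; ring.
Qed.

Lemma position_neq X : has_density X -> P (X @^-1` [set x]) = 0%E.
Proof.
move=> hX; have [B B0 hB] := square_prob.
have := hB X hX 0 (lexx 0) (ltW rho0_gt0); rewrite expr0n mulr0 square0.
by move=> h; apply/eqP; rewrite eq_le h measure_ge0.
Qed.

(** The cutoff [rho0] will be a T, beyond which the kernel vanishes on [0, T]. *)
Definition inv_dist (y : R * R) : R :=
  if (0 < dist2 x y) && (dist2 x y < rho0) then (dist2 x y)^-1 else 0.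

Lemma inv_dist_ge0 y : 0 <= inv_dist y.
Proof. by rewrite /inv_dist; case: ifP => // /andP[h _]; rewrite invr_ge0 ltW. Qed.

Lemma measurable_inv_dist : measurable_fun setT inv_dist.
Proof.
have md := measurable_dist2 x.
apply: measurable_fun_ifT => //.
  by apply: measurable_and; apply: measurable_fun_ltr.
have -> : (fun y => (dist2 x y)^-1) = (fun u => u `^ (-1)) \o dist2 x.
  by apply/funext => y /=; rewrite powR_inv1// dist2_ge0.
by apply: measurableT_comp => //; exact: measurable_powR.
Qed.

(* 1/r is of order 2^n on the n-th dyadic annulus, which has probability O(4^(-n)). *)
Let layer (n : nat) (y : R * R) : R :=
  2 ^+ n.+1 / rho0 * \1_(square (rho0 / 2 ^+ n)) y.

Let layer_ge0 n y : 0 <= layer n y.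
Proof. by rewrite mulr_ge0// divr_ge0 ?exprn_ge0// ltW. Qed.

Let inv_dist_le y : ((inv_dist y)%:E <= \sum_(n <oo) (layer n y)%:E)%E.
Proof.
rewrite /inv_dist; case: ifPn => [/andP[r0 rr]|_]; last first.
  by apply: nneseries_ge0 => n _ _; rewrite lee_fin.
have [m /andP[m1 m2]] := @dyadic_scale R (dist2 x y / rho0)
  ltac:(by rewrite divr_gt0) ltac:(by rewrite ler_pdivrMr// mul1r ltW).
apply: (@le_trans _ _ (layer m y)%:E).
  rewrite lee_fin /layer indicE mem_set; last first.
    by apply: dist2_square; rewrite mulrC -ler_pdivrMr.
  rewrite mulr1 invf_ple ?posrE ?divr_gt0 ?exprn_gt0//.
  rewrite invf_div; move: m1; rewrite ltr_pdivlMr// mulrC => /ltW.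
  by rewrite mulrC.
apply: le_trans (nneseries_lim_ge m.+1 _); last by move=> n _ _; rewrite lee_fin.
rewrite big_nat_recr//=; apply: leeDr.
by apply: sume_ge0 => n _; rewrite lee_fin.
Qed.

Lemma inv_dist_moment : exists C, forall X, has_density X ->
  (\int[P]_w (inv_dist (X w))%:E <= C%:E)%E.
Proof.
(* The n-th layer contributes (2^(n+1) / rho0) B (rho0 / 2^n)^2 = 2 B rho0 2^(-n). The constant is
   fixed before X, so it is common to all positions. *)
have [B B0 hB] := square_prob; exists (4 * B * rho0) => X hX.
have [mX _] := hX.
have mind n : measurable_fun setT (\1_(square (rho0 / 2 ^+ n)) : R * R -> R).
  by apply: measurable_indic; exact: measurable_square.
have mlayer n : measurable_fun setT (fun w => (layer n (X w))%:E).
  apply/measurable_EFinP; apply: measurable_funM => //.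
  exact: (measurableT_comp (mind n) mX).
apply: (@le_trans _ _ (\int[P]_w \sum_(n <oo) (layer n (X w))%:E)%E).
  apply: ge0_le_integral => //.
  - by move=> w _; rewrite lee_fin inv_dist_ge0.
  - apply/measurable_EFinP; apply: measurableT_comp => //; exact: measurable_inv_dist.
  - by apply: ge0_emeasurable_sum => // n w _ _; rewrite lee_fin.
rewrite integral_nneseries//; last by move=> n w _; rewrite lee_fin.
apply: lime_le; first by apply: is_cvg_nneseries => n _ _; apply: integral_ge0 => w _; rewrite lee_fin.
apply: nearW => N.
apply: (@le_trans _ _ (\sum_(0 <= n < N) (2 * B * rho0 * 2^-1 ^+ n)%:E)%E).
  apply: lee_sum => n _; rewrite /layer.
  under eq_integral do rewrite EFinM.
  have mS : measurable (X @^-1` square (rho0 / 2 ^+ n)).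
    by rewrite -[X in measurable X]setTI; apply: mX => //; exact: measurable_square.
  have p2 : 0 < 2 ^+ n :> R by rewrite exprn_gt0.
  have c0 : 0 <= 2 ^+ n.+1 / rho0 by rewrite divr_ge0 ?exprn_ge0// ltW.
  rewrite ge0_integralZl//; last first.
    apply/measurable_EFinP.
    exact: (measurableT_comp (mind n) mX).
  rewrite (_ : (\int[P]_w _)%E = P (X @^-1` square (rho0 / 2 ^+ n))); last first.
    transitivity (\int[P]_w (\1_(X @^-1` square (rho0 / 2 ^+ n)) w)%:E)%E => //.
    by rewrite integral_indic// setIT.
  apply: (@le_trans _ _ ((2 ^+ n.+1 / rho0)%:E * (B * (rho0 / 2 ^+ n) ^+ 2)%:E)%E).
    apply: lee_wpmul2l; first by rewrite lee_fin.
    apply: hB => //; first by rewrite divr_ge0 ?ltW.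
    by rewrite ler_pdivrMr// ler_peMr ?(ltW rho0_gt0)// exprn_ege1// ler1n.
  rewrite -EFinM lee_fin exprVn exprS le_eqVlt; apply/orP; left; apply/eqP.
  by field; rewrite !gt_eqF.
rewrite sumEFin lee_fin big_mkord -mulr_sumr.
have -> : \sum_(n < N) (2^-1 : R) ^+ n = 2 * (1 - 2^-1 ^+ N).
  elim: N => [|N IH]; first by rewrite big_ord0 expr0 subrr mulr0.
  by rewrite big_ord_recr/= IH exprS; lra.
have c0 : 0 <= B * rho0 by rewrite mulr_ge0// ltW.
have : B * rho0 * 2^-1 ^+ N >= 0 by rewrite mulr_ge0// exprn_ge0.
by lra.
Qed.

End positions.

(** * Power weights *)

Section power_weights.
Variable R : realType.

(** A discrete form of integral comparison that lets the series telescope. With h = 1 / (k + 2) it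
    is Bernoulli's inequality (1 - h)^(-q) >= 1 + q h, obtained from the tangents of exp and ln. *)
Lemma powR_step (q : R) k : 0 < q ->
  q * k.+2%:R `^ (- (q + 1)) <= k.+1%:R `^ (- q) - k.+2%:R `^ (- q).
Proof.
move=> q0; have k2 : 0 < k.+2%:R :> R by [].
pose h : R := k.+2%:R^-1.
have h0 : 0 < h by rewrite invr_gt0.
have h1 : h < 1 by rewrite invf_lt1// ltr1n.
have -> : k.+1%:R = k.+2%:R * (1 - h) :> R.
  by rewrite mulrBr mulr1 mulfV ?gt_eqF// -[k.+2%:R]natr1 addrK.
rewrite powRM ?subr_ge0 ?(ltW h1)//.
have -> : k.+2%:R `^ (- (q + 1)) = k.+2%:R `^ (- q) * h.
  by rewrite opprD powRD ?pnatr_eq0 ?implybT// powR_inv1.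
have e : 1 + q * h <= (1 - h) `^ (- q).
  rewrite /powR gt_eqF ?subr_gt0//; apply: le_trans (expR_ge1Dx _).
  rewrite lerD2l mulNr -mulrN ler_pM2l//.
  have := @le_ln1Dx R (- h) ltac:(by rewrite ltrN2).
  by lra.
have p0 : 0 <= k.+2%:R `^ (- q) :> R by exact: powR_ge0.
have := ler_wpM2l p0 e; lra.
Qed.

Lemma sum_powR_le (q : R) n : 0 < q ->
  \sum_(k < n) k.+1%:R `^ (- (q + 1)) <= 1 + q^-1 :> R.
Proof.
move=> q0; case: n => [|n]; first by rewrite big_ord0 addr_ge0// invr_ge0 ltW.
rewrite big_ord_recl/= powR1 lerD2l -(ler_pM2l q0) mulfV ?gt_eqF//.
have : q * (\sum_(i < n) (bump 0 i).+1%:R `^ (- (q + 1))) <= 1 - n.+1%:R `^ (- q).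
  elim: n => [|n IH]; first by rewrite big_ord0 mulr0 powR1 subrr.
  by rewrite big_ord_recr/= mulrDr; have := powR_step n q0; rewrite /bump/= add1n; lra.
by move=> /le_trans; apply; rewrite lerBlDr lerDl powR_ge0.
Qed.

Lemma powRV_natr_cvg0 (e : R) : 0 < e -> (fun k => (k.+1%:R `^ e)^-1) @ \oo --> (0 : R).
Proof.
move=> e0; apply/cvgr0Pnorm_le => d d0.
have := nbhs_infty_ger (d^-1 `^ e^-1); apply: filterS => k hk.
have p0 : 0 < k.+1%:R `^ e :> R by rewrite powR_gt0.
have p1 : 0 <= (k.+1%:R `^ e)^-1 :> R by rewrite invr_ge0 ltW.
rewrite (ger0_norm p1) invf_ple ?posrE//.
have d1 : 0 <= d^-1 by rewrite invr_ge0 ltW.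
have -> : d^-1 = (d^-1 `^ e^-1) `^ e by rewrite -powRrM mulVf ?gt_eqF// powRr1.
apply: ge0_ler_powR; rewrite ?nnegrE ?powR_ge0// ?(ltW e0)//.
by apply: le_trans hk _; rewrite ler_nat.
Qed.

Lemma powRV_natr_dec (e : R) k : 0 < e -> (k.+2%:R `^ e)^-1 <= (k.+1%:R `^ e)^-1 :> R.
Proof.
move=> e0; rewrite lef_pV2 ?posrE ?powR_gt0//.
by apply: ge0_ler_powR; rewrite ?nnegrE// ?ler_nat// ltW.
Qed.

Lemma eventually_le_bounded (u : nat -> R) (D : R) k0 : (forall k, 0 <= u k) ->
  (forall k, (k0 <= k)%N -> u k <= D) -> 0 <= D -> exists2 D', 0 <= D' & forall k, u k <= D'.
Proof.
move=> u0 uD D0; have s0 : 0 <= \sum_(i < k0) u i by exact: sumr_ge0.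
exists (D + \sum_(i < k0) u i); first by rewrite addr_ge0.
move=> k; have [kk|kk] := leqP k0 k; first by rewrite (le_trans (uD _ kk))// lerDl.
rewrite (bigD1 (Ordinal kk))//= [u k + _]addrC addrA lerDr.
by rewrite addr_ge0// sumr_ge0.
Qed.

(* The junk values of powR at nonpositive [G k] only affect finitely many [k]. *)
Lemma arrival_weight_le (eps ia c : R) (G : nat -> R) k0 : 0 < c -> 0 <= ia ->
  (forall k, (k0 <= k)%N -> c * k.+1%:R <= G k) ->
  exists2 D, 0 <= D & forall k,
    (k.+1%:R `^ eps * G k `^ (- ia)) ^+ 2 <= D * k.+1%:R `^ (- (2 * ia - 2 * eps)).
Proof.
move=> c0 ia0 hG; pose p := 2 * ia - 2 * eps.
have n0 k : 0 < k.+1%:R :> R by [].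
have p0 k : 0 < k.+1%:R `^ (- p) :> R by rewrite powR_gt0.
pose u k := (k.+1%:R `^ eps * G k `^ (- ia)) ^+ 2 / k.+1%:R `^ (- p).
have u0 k : 0 <= u k by rewrite divr_ge0 ?sqr_ge0 ?(ltW (p0 _)).
have [|D D0 hD] := @eventually_le_bounded u ((c `^ (- ia)) ^+ 2) k0 u0 _ (sqr_ge0 _).
  move=> k /hG h; rewrite /u ler_pdivrMr//.
  have ck : 0 < c * k.+1%:R by rewrite mulr_gt0.
  have Gk : 0 < G k := lt_le_trans ck h.
  have -> : k.+1%:R `^ (- p) = (k.+1%:R `^ eps * k.+1%:R `^ (- ia)) ^+ 2 :> R.
    rewrite -powRD ?pnatr_eq0 ?implybT// -powR_mulrn ?powR_ge0// -powRrM.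
    by congr (_ `^ _); rewrite /p; ring.
  rewrite -exprMn ler_sqr ?nnegrE ?mulr_ge0 ?powR_ge0// mulrCA ler_wpM2l ?powR_ge0//.
  rewrite -powRM ?(ltW c0)// !powRN lef_pV2 ?posrE ?powR_gt0//.
  by apply: ge0_ler_powR; rewrite ?nnegrE ?(ltW ck) ?(ltW Gk).
by exists D => // k; rewrite -ler_pdivrMr// hD.
Qed.

End power_weights.

(** * The LePage series *)

Section dyadic_nodes.

(* [2 ^ m + i] with [i < 2 ^ m] codes the i-th dyadic interval of level m. *)
Definition node_level (q : nat) : nat := trunc_log 2 q.
Definition node_index (q : nat) : nat := (q - 2 ^ node_level q) %% 2 ^ node_level q.

Lemma node_index_lt q : (node_index q < 2 ^ node_level q)%N.
Proof. by rewrite ltn_mod expn_gt0. Qed.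

Lemma node_levelE m i : (i < 2 ^ m)%N -> node_level (2 ^ m + i) = m.
Proof.
move=> im; apply: trunc_log_eq => //.
by rewrite leq_addr/= expnS mul2n -addnn ltn_add2l.
Qed.

Lemma node_indexE m i : (i < 2 ^ m)%N -> node_index (2 ^ m + i) = i.
Proof. by move=> im; rewrite /node_index node_levelE// addKn modn_small. Qed.

(** The price of the union bound at level m. The two factors are at most 2^(m+1) and 2^(m+2), and ln
    2 <= 1. *)
Lemma ln_node_le (R : realType) m i : (i < 2 ^ m)%N ->
  ln ((2 ^ m + i).+1%:R * (2 ^ m + i).+2%:R) <= 2 * m%:R + 3 :> R.
Proof.
move=> im.
have h1 : (2 ^ m + i).+1%:R <= 2 ^+ m.+1 :> R.
  by rewrite -natrX ler_nat expnS mul2n -addnn -addnS leq_add2l.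
have h2 : (2 ^ m + i).+2%:R <= 2 ^+ m.+2 :> R.
  rewrite -natrX ler_nat !expnS; have : (1 <= 2 ^ m)%N by rewrite expn_gt0.
  by move: (2 ^ m)%N im => k; lia.
have : ln ((2 ^ m + i).+1%:R * (2 ^ m + i).+2%:R) <= ln (2 ^+ (m.+1 + m.+2)) :> R.
  by rewrite ler_ln ?posrE ?mulr_gt0 ?exprn_gt0// exprD ler_pM.
move=> /le_trans; apply; rewrite lnXn// -[ln 2 *+ _]mulr_natr.
have ln2 : ln (2 : R) <= 1.
  have := @le_ln1Dx R 1 ltac:(lra).
  by rewrite (_ : 1 + 1 = 2 :> R).
have e : (m.+1 + m.+2)%N%:R = 2 * m%:R + 3 :> R.
  by rewrite !addSn !addnS addnn -mul2n -!natr1 natrM; ring.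
by rewrite e -[leRHS]mul1r ler_wpM2r.
Qed.

End dyadic_nodes.

(** * Path regularity for a fixed outcome *)

Section path.
Variable R : realType.
Variables (alpha a T M : R) (sigma : R * R -> R -> R) (phi : R * R -> R) (x : R * R).
Hypotheses (alpha_gt0 : 0 < alpha) (alpha_lt2 : alpha < 2).
Hypotheses (a_gt0 : 0 < a) (T_gt0 : 0 < T).
Hypothesis sigma_cont : {within [set p : (R * R) * R | 0 <= p.2],
  continuous (fun p => sigma p.1 p.2)}.
Hypothesis sigmaM : forall y t, 0 <= t -> `|sigma y t| <= M.
Hypotheses (phi_cont : continuous phi) (phi_gt0 : forall y, 0 < phi y).

(** With this eps, 2 / alpha - 2 eps = 1 + 2 eps: half of the margin 2 / alpha - 1 pays for the
    weights k^eps, the other half keeps the variances summable. *)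
Definition weight_exp : R := (2 * alpha^-1 - 1) / 4.

Let ia_gt : 1 < 2 * alpha^-1.
Proof. by rewrite ltr_pdivlMr// mul1r. Qed.

Lemma weight_exp_gt0 : 0 < weight_exp.
Proof. by rewrite divr_gt0// subr_gt0. Qed.

Definition lepage_coef (G : R) (y : R * R) : R :=
  G `^ (- alpha^-1) * phi y `^ (- alpha^-1).

(** The coefficient of g_k in the weighted increment over the q-th dyadic interval, normalized by
    the root of its length so that the sum of squares is bounded uniformly in q. *)
Definition node_coef (q k : nat) (G : R) (y : R * R) : R :=
  let m := node_level q in let i := node_index q in
  k.+1%:R `^ weight_exp * lepage_coef G y *
  ((Gker a sigma x y (T * (i.+1%:R / 2 ^+ m)) - Gker a sigma x y (T * (i%:R / 2 ^+ m)))
   / Num.sqrt (T / 2 ^+ m)).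

Let node_diff m i : T * (i.+1%:R / 2 ^+ m) - T * (i%:R / 2 ^+ m) = T / 2 ^+ m.
Proof. by rewrite -mulrBr -mulrBl -natr1 addrAC subrr add0r mul1r. Qed.

Let step_gt0 m : 0 < T / 2 ^+ m. Proof. by rewrite divr_gt0// exprn_gt0. Qed.

Let C := Gker_const a M.

Lemma node_increment_le m i y : (i < 2 ^ m)%N -> 0 < dist2 x y ->
  ((Gker a sigma x y (T * (i.+1%:R / 2 ^+ m)) - Gker a sigma x y (T * (i%:R / 2 ^+ m)))
   / Num.sqrt (T / 2 ^+ m)) ^+ 2 <= C ^+ 2 * inv_dist x (a * T) y.
Proof.
move=> im r0; have p2 : 0 < 2 ^+ m :> R by rewrite exprn_gt0.
have [rr|rr] := ltP (dist2 x y) (a * T); last first.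
  have zero j : (j <= 2 ^ m)%N -> Gker a sigma x y (T * (j%:R / 2 ^+ m)) = 0.
    move=> jm; apply: Gker_eq0; apply: le_trans rr.
    rewrite ler_pM2l// -[leRHS]mulr1 ler_pM2l// ler_pdivrMr// mul1r.
    by rewrite -natrX ler_nat.
  rewrite !zero//; last exact: ltnW.
  by rewrite subrr mul0r expr0n/= mulr_ge0 ?sqr_ge0// inv_dist_ge0.
rewrite /inv_dist r0 rr/=.
have := Gker_increment a_gt0 sigma_cont sigmaM (T * (i%:R / 2 ^+ m)) (T * (i.+1%:R / 2 ^+ m)) r0.
rewrite node_diff (gtr0_norm (step_gt0 m)) => h.
have s0 : 0 < Num.sqrt (T / 2 ^+ m) by rewrite sqrtr_gt0.
rewrite -ler_pdivrMr// in h.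
rewrite -[leLHS]real_normK ?num_real// normrM (gtr0_norm (x := _^-1)) ?invr_gt0//.
have C0 : 0 <= C by exact: (Gker_const_ge0 a_gt0 sigmaM).
have -> : C ^+ 2 / dist2 x y = (C / Num.sqrt (dist2 x y)) ^+ 2.
  by rewrite [RHS]exprMn exprVn (sqr_sqrtr (ltW r0)).
have n1 : 0 <= C / Num.sqrt (dist2 x y) by exact: divr_ge0.
rewrite ler_sqr ?nnegrE//; exact: divr_ge0.
Qed.

Lemma node_coef_sum_le (G : nat -> R) (xi : nat -> R * R) (c B : R) k0 :
  0 < c -> (forall k, (k0 <= k)%N -> c * k.+1%:R <= G k) ->
  (forall k, 0 < dist2 x (xi k)) ->
  (forall n, \sum_(k < n) k.+1%:R `^ (- (2 * alpha^-1 - 2 * weight_exp)) *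
     inv_dist x (a * T) (xi k) <= B) ->
  exists2 V, 0 <= V & forall q n, \sum_(k < n) node_coef q k (G k) (xi k) ^+ 2 <= V.
Proof.
move=> c0 hG r0 hB; have aT : 0 < a * T by rewrite mulr_gt0.
have ia0 : 0 <= alpha^-1 by rewrite invr_ge0 ltW.
have [D D0 hD] := arrival_weight_le weight_exp c0 ia0 hG.
have [b b0 hb] := density_square_lb phi_cont phi_gt0 x (ltW aT).
pose K := D * (b `^ (- alpha^-1)) ^+ 2 * C ^+ 2.
have K0 : 0 <= K by apply: mulr_ge0; [apply: mulr_ge0 => //|]; exact: sqr_ge0.
have B0 : 0 <= B by have := hB 0%N; rewrite big_ord0.
exists (K * B); first by rewrite mulr_ge0.
move=> q n; apply: le_trans (ler_wpM2l K0 (hB n)).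
rewrite mulr_sumr; apply: ler_sum => k _; rewrite /node_coef/= /lepage_coef.
have hI := node_increment_le (node_index_lt q) (r0 k).
have reorder (u1 u2 u3 u4 : R) :
    (u1 * (u2 * u3) * u4) ^+ 2 = (u1 * u2) ^+ 2 * u3 ^+ 2 * u4 ^+ 2 by ring.
rewrite reorder {reorder}.
(* [phi] has a positive lower bound only on bounded sets; beyond distance a T the increment is zero
   and none is required. *)
have [rr|rr] := ltP (dist2 x (xi k)) (a * T); last first.
  have z : inv_dist x (a * T) (xi k) = 0 by rewrite /inv_dist [_ < a * T]ltNge rr andbF.
  rewrite z mulr0 in hI; rewrite z !mulr0.
  by rewrite (le_anti (introT andP (conj hI (sqr_ge0 _)))) mulr0.
have hphi : (phi (xi k) `^ (- alpha^-1)) ^+ 2 <= (b `^ (- alpha^-1)) ^+ 2.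
  have hbk : b <= phi (xi k) by apply: hb; apply: dist2_square; exact: ltW.
  rewrite ler_sqr ?nnegrE ?powR_ge0// !powRN lef_pV2 ?posrE ?powR_gt0//.
  by apply: ge0_ler_powR; rewrite ?nnegrE ?(ltW b0) ?(ltW (phi_gt0 _)).
apply: (@le_trans _ _ ((D * k.+1%:R `^ (- (2 * alpha^-1 - 2 * weight_exp))) *
   (b `^ (- alpha^-1)) ^+ 2 * (C ^+ 2 * inv_dist x (a * T) (xi k)))).
  apply: ler_pM; [by apply: mulr_ge0; exact: sqr_ge0|exact: sqr_ge0| |exact: hI].
  by apply: ler_pM; [exact: sqr_ge0|exact: sqr_ge0|exact: hD|exact: hphi].
by rewrite le_eqVlt; apply/orP; left; apply/eqP; rewrite /K; ring.
Qed.

Definition lepage_term (G : nat -> R) (xi : nat -> R * R) (g : nat -> R) k t : R :=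
  lepage_coef (G k) (xi k) * Gker a sigma x (xi k) t * g k.

(** A deterministic statement about one outcome: probability enters through its hypotheses only. The
    constant [C_alpha] is left out and restored in the theorem. *)
Lemma lepage_path_hoelder (G : nat -> R) (xi : nat -> R * R) (g : nat -> R) (c V s : R) :
  (forall k, 0 < dist2 x (xi k)) -> 0 <= c -> 0 <= V ->
  (forall q n, \sum_(k < n) node_coef q k (G k) (xi k) ^+ 2 <= V) ->
  (forall q n, `|\sum_(k < n) node_coef q k (G k) (xi k) * g k| <=
     ln (q.+1%:R * q.+2%:R) + c +
       s ^+ 2 / 2 * \sum_(k < n) node_coef q k (G k) (xi k) ^+ 2) ->
  exists U : R -> R,
    (forall t, 0 <= t <= T ->
       (fun n => \sum_(k < n) lepage_term G xi g k t) @ \oo --> U t) /\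
    (forall beta, 0 < beta -> beta < 1 / 2 -> hoelder_on T beta U).
Proof.
move=> r0 c0 V0 hV hq; have e0 := weight_exp_gt0.
have v0 k : 0 < (k.+1%:R `^ weight_exp)^-1 :> R by rewrite invr_gt0 powR_gt0.
have s2 : 0 <= s ^+ 2 / 2 by rewrite divr_ge0 ?sqr_ge0.
apply: (@weighted_series_hoelder _ T (3 + c + s ^+ 2 / 2 * V)
  (fun k => (k.+1%:R `^ weight_exp)^-1) (lepage_term G xi g)
  (fun k => `|lepage_coef (G k) (xi k)| * (C / Num.sqrt (dist2 x (xi k))) * `|g k|)) => //.
- by apply: addr_ge0; [exact: addr_ge0|exact: mulr_ge0].
- by move=> k; exact: powRV_natr_dec.
- exact: powRV_natr_cvg0.
- move=> k; rewrite /lepage_term Gker_eq0 ?mulr0 ?mul0r//; exact: dist2_ge0.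
- move=> k u t _ _; rewrite /lepage_term -mulrBl -mulrBr !normrM.
  rewrite [leRHS]mulrAC ler_wpM2r// -[leRHS]mulrA ler_wpM2l//.
  exact: (Gker_increment a_gt0 sigma_cont sigmaM).
move=> n m i im; have := hq (2 ^ m + i)%N n.
rewrite /node_coef/= (node_levelE im) (node_indexE im) => h.
have := hV (2 ^ m + i)%N n.
rewrite /node_coef/= (node_levelE im) (node_indexE im) => hVn.
have s0 : 0 < Num.sqrt (T / 2 ^+ m) by rewrite sqrtr_gt0.
have -> : \sum_(k < n) lepage_term G xi g k (T * (i.+1%:R / 2 ^+ m)) / (k.+1%:R `^ weight_exp)^-1
    - \sum_(k < n) lepage_term G xi g k (T * (i%:R / 2 ^+ m)) / (k.+1%:R `^ weight_exp)^-1
  = Num.sqrt (T / 2 ^+ m) * \sum_(k < n) k.+1%:R `^ weight_exp * lepage_coef (G k) (xi k) *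
    ((Gker a sigma x (xi k) (T * (i.+1%:R / 2 ^+ m)) -
      Gker a sigma x (xi k) (T * (i%:R / 2 ^+ m))) / Num.sqrt (T / 2 ^+ m)) * g k.
  rewrite -sumrB mulr_sumr; apply: eq_bigr => k _.
  rewrite invrK /lepage_term; move: (Gker _ _ _ _ _) (Gker _ _ _ _ _) => u1 u2.
  by field; rewrite gt_eqF.
rewrite normrM (gtr0_norm s0) ler_pM2l//.
apply: le_trans h _.
have h1 := ln_node_le R im; have h2 := ler_wpM2l s2 hVn.
by lra.
Qed.

End path.

Unset Implicit Arguments.

Theorem theorem4 (R : realType) (d : measure_display) (Omega : measurableType d)
  (P : probability Omega R) (alpha a gamma : R) (sigma : R * R -> R -> R)
  (phi : R * R -> R) (E Gam : nat -> Omega -> R) (xi : nat -> Omega -> R * R)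
  (g : nat -> Omega -> R) :
  0 < alpha -> alpha < 2 -> 0 < a ->
  {within [set p : (R * R) * R | 0 <= p.2], continuous (fun p => sigma p.1 p.2)} ->
  (exists M : R, forall y t, 0 <= t -> `|sigma y t| <= M) ->
  0 < gamma -> gamma <= 1 ->
  (forall y t s, 0 <= t -> 0 <= s -> `|sigma y t - sigma y s| <= `|t - s| `^ gamma) ->
  continuous phi -> (forall y, 0 < phi y) ->
  (\int[leb2]_y (phi y)%:E)%E = 1%E ->
  lepage_setting P alpha phi E Gam xi g ->
  forall (T : R) (x : R * R), 0 < T ->
  {ae P, forall w, exists U : R -> R,
     (forall t, 0 <= t <= T ->
        U_partial alpha a sigma phi (Gam^~ w) (xi^~ w) (g^~ w) x t @ \oo --> U t) /\
     (forall beta, 0 < beta -> beta < Num.min gamma (1 / 2) -> hoelder_on T beta U)}.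
Proof.
move=> alpha_gt0 alpha_lt2 a_gt0 sigma_cont [M sigmaM] _ _ _ phi_cont phi_gt0 _.
move=> [mE [mxi [mg [E_law [GamE [xi_law [[s s_gt0 g_law] [_ indep]]]]]]]] T x T_gt0.
have sigmaM' y t : 0 <= t -> `|sigma y t| <= M by exact: sigmaM.
pose F (i : nat + (nat + nat)) : set (set Omega) := match i with
  | inl k => preimg_sets (E k)
  | inr (inl k) => preimg_sets (xi k)
  | inr (inr k) => preimg_sets (g k) end.
have F_setI i : setI_closed (F i).
  by case: i => [k|[k|k]]; exact: preimg_sets_setI.
have F_setT i : F i setT.
  by case: i => [k|[k|k]]; exact: preimg_sets_setT.
have F_measurable i A : F i A -> measurable A.
  by case: i => [k|[k|k]]; exact: preimg_sets_measurable.
(* Everything except the Gaussian variables: the sigma-algebra on which one would condition. *)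
pose H0 : pred (nat + (nat + nat)) := fun i => if i is inr (inr _) then false else true.
have E_F k B : measurable B -> F (inl k) (E k @^-1` B) by exists B.
have xi_F k B : measurable B -> F (inr (inl k)) (xi k @^-1` B) by exists B.
have g_F k B : measurable B -> F (inr (inr k)) (g k @^-1` B) by exists B.
have E_H k : measurable_wrt F H0 (E k) by exact: (measurable_wrt_gen (i := inl k) _ (E_F k)).
have xi_H k : measurable_wrt F H0 (xi k).
  exact: (measurable_wrt_gen (i := inr (inl k)) _ (xi_F k)).
have Gam_H k : measurable_wrt F H0 (Gam k).
  have -> : Gam k = fun w => \sum_(i < k.+1) E i w by apply/funext => w; exact: GamE.
  by apply: measurable_sum => i; exact: E_H.
pose b q k w := node_coef alpha a T sigma phi x q k (Gam k w) (xi k w).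
have b_H q k : measurable_wrt F H0 (b q k).
  have mpow (p : R) : measurable_fun setT (fun u : R => u `^ p) by exact: measurable_powR.
  have mphi := continuous_measurable2 phi_cont.
  have mG t := measurable_Gker a sigma_cont x t.
  rewrite /b /node_coef /lepage_coef; apply: measurable_funM.
    apply: measurable_funM => //; apply: measurable_funM.
      exact: (measurableT_comp (mpow _) (Gam_H k)).
    exact: (measurableT_comp (mpow _) (measurableT_comp mphi (xi_H k))).
  apply: measurable_funM => //; apply: measurable_funB.
    exact: (measurableT_comp (mG _) (xi_H k)).
  exact: (measurableT_comp (mG _) (xi_H k)).
have j_inj : injective (fun k : nat => inr (inr k) : nat + (nat + nat)) by move=> k k' [].
have g_mgf k (u : R) : (\int[P]_w (expR (u * g k w - s ^+ 2 / 2 * u ^+ 2))%:E = 1)%E.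
  by apply: normal_mgf => //; exact: g_law.
have hsum := ae_sum_bound F_setI F_setT F_measurable indep
  (H0 := H0) (j := fun k => inr (inr k)) (g := g) (s := s)
  j_inj (fun k => isT) g_F g_mgf b_H.
have [c c_gt0 hgrow] := arrival_growth F_setI F_setT F_measurable indep
  (j := inl) (E := E) (fun k k' e => ltac:(by case: e)) E_F E_law.
have aT : 0 < a * T by rewrite mulr_gt0.
have hd k : has_density phi P (xi k) by split; [exact: mxi|exact: xi_law].
have hneq : {ae P, forall w, forall k, 0 < dist2 x (xi k w)}.
  apply/ae_foralln => k; exists (xi k @^-1` [set x]); split.
  - rewrite -[X in measurable X]setTI; apply: mxi => //.
    have -> : [set x] = square x 0 by rewrite square0.
    exact: measurable_square.
  - exact: (position_neq phi_cont phi_gt0 x aT (hd k)).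
  - move=> w /= /negP; rewrite -leNgt => h.
    by have := dist2_square h; rewrite square0.
have [C hC] := inv_dist_moment phi_cont phi_gt0 x P aT.
pose p := (2 * alpha^-1 - 1) / 2.
have ia_gt : 1 < 2 * alpha^-1 by rewrite ltr_pdivlMr// mul1r.
have p_gt0 : 0 < p by rewrite divr_gt0// subr_gt0.
have pE : 2 * alpha^-1 - 2 * weight_exp alpha = p + 1.
  by rewrite /weight_exp /p; lra.
have C0 : 0 <= C.
  rewrite -lee_fin; apply: le_trans (hC _ (hd 0%N)).
  by apply: integral_ge0 => w _; rewrite lee_fin inv_dist_ge0.
have hinv : {ae P, forall w, exists B, forall n,
    \sum_(k < n) k.+1%:R `^ (- (p + 1)) * inv_dist x (a * T) (xi k w) <= B}.
  apply: (@ae_summable _ _ _ P (fun k w => k.+1%:R `^ (- (p + 1)) * inv_dist x (a * T) (xi k w))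
    (fun k => k.+1%:R `^ (- (p + 1)) * C) ((1 + p^-1) * C)).
  - move=> k; apply: measurable_funM => //.
    apply: measurableT_comp => //; exact: measurable_inv_dist.
  - by move=> k w; rewrite mulr_ge0 ?powR_ge0 ?inv_dist_ge0.
  - move=> k; under eq_integral do rewrite EFinM.
    have mI : measurable_fun setT (fun w => (inv_dist x (a * T) (xi k w))%:E).
      apply/measurable_EFinP; apply: measurableT_comp => //; exact: measurable_inv_dist.
    have I0 w : (0 <= (inv_dist x (a * T) (xi k w))%:E)%E by rewrite lee_fin inv_dist_ge0.
    have p0 : (0 <= (k.+1%:R `^ (- (p + 1)) : R)%:E)%E by rewrite lee_fin powR_ge0.
    rewrite (ge0_integralZl _ measurableT mI (fun w _ => I0 w))//.
    by rewrite EFinM; apply: lee_wpmul2l => //; exact: hC.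
  - by move=> n; rewrite -mulr_suml ler_wpM2r// sum_powR_le.
(* The outcome is fixed here, before t and beta are chosen. *)
apply: filterS3 (filterI hsum hgrow) hneq hinv => w [[c' [c'0 hb]] [k0 hG]] hr [B hB].
(* The shift of index: [Gam k] is a sum of k + 1 exponential variables. *)
have hG' k : (k0 <= k)%N -> c * k.+1%:R <= Gam k w.
  by move=> kk; rewrite GamE; apply: hG; rewrite leqW.
have [V V0 hV] := @node_coef_sum_le _ alpha a T M sigma phi x alpha_gt0 a_gt0 T_gt0
  sigma_cont sigmaM' phi_cont phi_gt0 (Gam^~ w) (xi^~ w) c B k0 c_gt0 hG' hr
  ltac:(by rewrite pE).
have [U [hU hH]] := @lepage_path_hoelder _ alpha a T M sigma phi x alpha_gt0 alpha_lt2 a_gt0 T_gt0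
  sigma_cont sigmaM' (Gam^~ w) (xi^~ w) (g^~ w) c' V s hr c'0 V0 hV hb.
exists (fun t => Calpha alpha * U t); split.
  move=> t tT; apply: cvgM; first exact: cvg_cst.
  exact: hU.
move=> beta b0; rewrite lt_min => /andP[_ b2].
have [K hK] := hH beta b0 b2; exists (`|Calpha alpha| * K) => u t uT tT.
by rewrite -mulrBr normrM -mulrA ler_wpM2l// hK.
Qed.
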